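(* Let $f:\mathbb R\to\mathbb R$ be a continuous $2\pi$-periodic function which is piecewise $C^1$, with $\langle f,f\rangle>0$ and $\langle f',f'\rangle>0$. Let $X_\infty=(X_\infty(t))_{t\in\mathbb R}$ be the stationary centered Gaussian process (with continuous sample paths) with covariance $\mathbb E[X_\infty(s)X_\infty(t)]=\rho(t-s)$, where $\rho(u)=\frac1u\int_0^u(f*\check f)(x)\,dx$ for $u\neq0$ and $\rho(0)=\langle f,f\rangle$. Then for every $[a,b]\subset\mathbb R$, $$\mathbb E[\mathcal N(X_\infty,[a,b])]=\frac{b-a}{\pi}\sqrt{\frac13\,\frac{\langle f',f'\rangle}{\langle f,f\rangle}}.$$
   Context: $\mathcal N(h,[a,b]):=\mathrm{Card}\{t\in[a,b]:h(t)=0\}$. $\langle g,h\rangle=\frac1{2\pi}\int_0^{2\pi}g(x)h(x)\,dx$; $(g*h)(x)=\frac1{2\pi}\int_0^{2\pi}g(u)h(x-u)\,du$ for $2\pi$-periodic $g,h$; $\check f(x):=f(-x)$. A $2\pi$-periodic function is piecewise $C^1$ if there is a finite partition of $[0,2\pi]$ such that on each subinterval $[s_j,s_{j+1})$ it coincides with a function that is $C^1$ on $[s_j,s_{j+1}]$. *)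

(* Defs.v *)
From HB Require Import structures.
From mathcomp Require Import all_boot all_order all_algebra.
From mathcomp Require Import all_classical all_reals all_analysis.

Set Implicit Arguments.
Unset Strict Implicit.
Unset Printing Implicit Defensive.

Import Order.TTheory GRing.Theory Num.Theory.
Import numFieldNormedType.Exports.

Local Open Scope classical_set_scope.
Local Open Scope ring_scope.

Section PeriodicFunctions.
Context {R : realType}.
Implicit Types f g h : R -> R.

(* One-sided derivatives at the end points. *)
Definition C1_on g (c d : R) : Prop :=
  exists g' : R -> R,
    {within `[c, d], continuous g'} /\
    forall x, x \in `[c, d] ->
      (fun y => (g y - g x) / (y - x)) @ within `[c, d] x^' --> g' x.

Definition piecewise_C1 f : Prop :=
  exists (n : nat) (s : nat -> R),
    [/\ s 0%N = 0, s n = 2 * pi &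
      forall j, (j < n)%N -> s j < s j.+1 /\
        exists g, C1_on g (s j) (s j.+1) /\
          forall x, x \in `[s j, s j.+1[ -> f x = g x].

Definition inner g h : R :=
  (2 * pi)^-1 * \int[lebesgue_measure]_(x in `[0, 2 * pi]) (g x * h x).

Definition conv g h (x : R) : R :=
  (2 * pi)^-1 * \int[lebesgue_measure]_(u in `[0, 2 * pi]) (g u * h (x - u)).

Definition reflect_fun f (x : R) : R := f (- x).

(* The oriented integral from 0 to u, for u of either sign. *)
Definition int_from0 f (u : R) : R :=
  if 0 <= u then \int[lebesgue_measure]_(x in `[0, u]) f x
  else - \int[lebesgue_measure]_(x in `[u, 0]) f x.

Definition rho f (u : R) : R :=
  if u == 0 then inner f f else u^-1 * int_from0 (conv f (reflect_fun f)) u.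

(* Takes the value +oo when there are infinitely many zeros. *)
Definition nb_zeros h (a b : R) : \bar R :=
  counting [set t | t \in `[a, b] /\ h t = 0].

End PeriodicFunctions.

Section Processes.
Context d {Omega : measurableType d} {R : realType}.
Variable P : probability Omega R.

(* [normal_prob m 0] is not the Dirac mass at m, hence the case distinction. *)
Definition gaussian_law (m s : R) (A : set R) : \bar R :=
  if s == 0 then \d_m A else normal_prob m s A.

Definition is_gaussian (Y : Omega -> R) : Prop :=
  exists m s : R, 0 <= s /\
    forall A : set R, measurable A -> P (Y @^-1` A) = gaussian_law m s A.

Definition gaussian_process (X : R -> {RV P >-> R}) : Prop :=
  forall (n : nat) (t c : 'I_n -> R),
    is_gaussian (fun w => \sum_(i < n) c i * X (t i) w).

Definition centered (X : R -> {RV P >-> R}) : Prop :=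
  forall t, ('E_P[X t] = 0)%E.

Definition stationary (X : R -> {RV P >-> R}) : Prop :=
  forall (h : R) (n : nat) (t : 'I_n -> R) (B : 'I_n -> set R),
    (forall i, measurable (B i)) ->
    P [set w | forall i, B i (X (t i + h) w)] =
    P [set w | forall i, B i (X (t i) w)].

Definition continuous_paths (X : R -> {RV P >-> R}) : Prop :=
  forall w, continuous (fun t => X t w : R).

End Processes.

(* Main.v *)
From HB Require Import structures.
From mathcomp Require Import all_boot all_order all_algebra.
From mathcomp Require Import finmap all_classical all_reals all_analysis.
From mathcomp Require Import measurable_realfun.
From mathcomp Require Import ring lra.
Require Import Defs.
Import Order.TTheory GRing.Theory Num.Theory.
Import numFieldNormedType.Exports.

Set Implicit Arguments.
Unset Strict Implicit.
Unset Printing Implicit Defensive.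

Local Open Scope classical_set_scope.
Local Open Scope ring_scope.

(** Cut [a, b] into [n] equal pieces and let [N_n] be the number of pieces on
    which [X] changes sign.  By the intermediate value theorem [N_n] is at most
    the number [N] of zeros; conversely a zero near which [X] takes both signs
    is detected by every fine mesh, so that [N <= liminf N_n] as soon as no zero
    is a local extremum.  Fatou's lemma then gives [E N = lim E N_n].

    Both the estimate of [E N_n] and the absence of tangential zeros come from
    the regression of [X] on one of its values: the family [X t] has the law of
    [c t * z + (X t - c t * X s)] with [z] an independent copy of [X s] and
    [c t = rho (t - s) / rho 0].  Given the residual, a sign change over a step
    [h] confines [z] to an interval of length proportional to [h], which yields
    the probability [h * sqrt (2 * kappa / rho 0) / pi + o(h)] when
    [rho h = rho 0 - kappa * h ^ 2 + o(h ^ 2)]; and given the residual, the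
    maximum of [X] over a short interval is strictly increasing in [z], hence
    vanishes with probability 0.  Independence is obtained from the Gaussian
    cosine transform, which determines the law of a finite family.

    Finally [kappa = <f', f'> / 6]: the autocorrelation of [f] differs from its
    value at 0 by half a mean square increment of [f]. *)

(** * Cosine transforms and box probabilities *)

(** Only continuity of the paths is available, so there is no derivative process whose joint density
    with [X t] could be integrated, and invertibility of the covariance matrices is not established
    either. Regression on a single value asks only for [0 < r 0]; the other values enter through a
    residual that is frozen while [z] varies. The events to be handled, a sign change or a maximum
    close to 0, are disjoint unions or differences of boxes, so it suffices to transfer
    probabilities of boxes from one law to another. The constant has two sources. The density of [z]
    at 0 is [1 / (sigma sqrt (2 pi))], and a centered normal residual of deviation [tau] has mean
    absolute value [tau sqrt (2 / pi)]; their product is [tau / (pi sigma)], where [tau] is of order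
    [h sqrt (2 kappa)]. The divisor 6 in [kappa] appears when the quadratic defect of the
    autocorrelation is averaged over [[0, u]]. The number of zeros is integrated without a proof
    that it is measurable, which explains the two comparison lemmas that precede the Rice
    formula. *)

Section BoundedConvergence.
Context {R : realType} {d : measure_display} {T : measurableType d}.
Variable P : probability T R.

Lemma bounded_integrable (g : T -> R) (M : R) :
  measurable_fun setT g -> (forall w, `|g w| <= M) ->
  P.-integrable setT (EFin \o g).
Proof.
move=> mg gM; apply: measurable_bounded_integrable => //.
  by rewrite /= probability_setT ltry.
exists M; split; first exact: num_real.
by move=> y My x _ /=; apply: le_trans (gM x) (ltW My).
Qed.

Lemma bounded_cvg_Rintegral (g_ : nat -> T -> R) (g : T -> R) (M : R) :
  (forall n, measurable_fun setT (g_ n)) -> (forall n w, `|g_ n w| <= M) ->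
  (forall w, g_ n w @[n --> \oo] --> g w) ->
  measurable_fun setT g /\ \int[P]_w g_ n w @[n --> \oo] --> \int[P]_w g w.
Proof.
move=> mg gM gg.
have mg' : measurable_fun setT (EFin \o g).
  apply: (@emeasurable_fun_cvg _ _ _ _ (fun n => EFin \o g_ n)).
    by move=> n; apply/measurable_EFinP.
  by move=> w _; apply: cvg_EFin; [exact: nearW|exact: gg].
have mgR : measurable_fun setT g by exact/measurable_EFinP.
split=> //.
have [] := @dominated_convergence _ _ _ P setT measurableT
  (fun n => EFin \o g_ n) (EFin \o g) (EFin \o cst M).
- by move=> n; exact/measurable_EFinP.
- by [].
- by apply: aeW => w _; apply: cvg_EFin; [exact: nearW|exact: gg].
- by apply: (@bounded_integrable _ `|M|).
- by apply: aeW => w n _ /=; rewrite lee_fin.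
move=> ig _ /= h; apply: fine_cvg.
by rewrite fineK//; exact: integrable_fin_num.
Qed.

End BoundedConvergence.

Section TrigPolynomials.
Context {R : realType} {n : nat}.
Implicit Types (u y : 'I_n -> R) (g h : ('I_n -> R) -> R).

(** The phase [t] brings sines and constants into the class, and the product-to-sum formula closes
    it under multiplication, so that real cosines do the work of complex exponentials. *)
Inductive trig_poly : (('I_n -> R) -> R) -> Prop :=
| trig_cos c u t : trig_poly (fun y => c * cos (\sum_i u i * y i + t))
| trig_add g h : trig_poly g -> trig_poly h -> trig_poly (fun y => g y + h y).

Lemma trig_polyM g h : trig_poly g -> trig_poly h ->
  trig_poly (fun y => g y * h y).
Proof.
move=> tg th; elim: tg => [c u t|g1 g2 _ ih1 _ ih2]; last first.
  rewrite (_ : (fun y => _) = (fun y => g1 y * h y + g2 y * h y)).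
    exact: trig_add.
  by apply/funext => y; rewrite mulrDl.
elim: th => [c' u' t'|g1 g2 _ ih1 _ ih2]; last first.
  rewrite (_ : (fun y => _) = (fun y => c * cos (\sum_i u i * y i + t) * g1 y
     + c * cos (\sum_i u i * y i + t) * g2 y)).
    exact: trig_add.
  by apply/funext => y; rewrite mulrDr.
rewrite (_ : (fun y => _) = (fun y =>
   c * c' / 2 * cos (\sum_i (u i + u' i) * y i + (t + t')) +
   c * c' / 2 * cos (\sum_i (u i - u' i) * y i + (t - t')))).
  by apply: trig_add; exact: trig_cos.
apply/funext => y.
set A := \sum_i u i * y i + t; set B := \sum_i u' i * y i + t'.
have -> : \sum_i (u i + u' i) * y i + (t + t') = A + B.
  rewrite /A /B addrACA -big_split/=; congr (_ + _).
  by apply: eq_bigr => i _; rewrite mulrDl.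
have -> : \sum_i (u i - u' i) * y i + (t - t') = A - B.
  rewrite /A /B opprD addrACA -sumrB/=; congr (_ + _).
  by apply: eq_bigr => i _; rewrite mulrBl.
by move: A B => A B; rewrite cosD cosB; field.
Qed.

Lemma trig_poly_cst c : trig_poly (fun=> c).
Proof.
rewrite (_ : (fun=> c) = (fun y => c * cos (\sum_i 0 * y i + 0))).
  exact: trig_cos.
apply/funext => y; rewrite big1 ?addr0 ?cos0 ?mulr1// => i _.
by rewrite mul0r.
Qed.

Lemma trig_polyX g k : trig_poly g -> trig_poly (fun y => g y ^+ k).
Proof.
move=> tg; elim: k => [|k ih].
  rewrite (_ : (fun y => _) = fun=> 1); first exact: trig_poly_cst.
  by apply/funext => y; rewrite expr0.
rewrite (_ : (fun y => _) = fun y => g y * g y ^+ k); first exact: trig_polyM.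
by apply/funext => y; rewrite exprS.
Qed.

Lemma trig_poly_prod (I : Type) (r : seq I) (g : I -> ('I_n -> R) -> R) :
  (forall i, trig_poly (g i)) -> trig_poly (fun y => \prod_(i <- r) g i y).
Proof.
move=> tg; elim: r => [|i r ih].
  rewrite (_ : (fun y => _) = fun=> 1); first exact: trig_poly_cst.
  by apply/funext => y; rewrite big_nil.
rewrite (_ : (fun y => _) = fun y => g i y * \prod_(j <- r) g j y).
  exact: trig_polyM.
by apply/funext => y; rewrite big_cons.
Qed.

Lemma trig_poly_coord (i : 'I_n) (a t : R) :
  trig_poly (fun y => cos (a * y i + t)).
Proof.
rewrite (_ : (fun y => _) =
  (fun y => 1 * cos (\sum_j (if j == i then a else 0) * y j + t))).
  exact: trig_cos.
apply/funext => y; rewrite mul1r (bigD1 i)//= eqxx big1 ?addr0//.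
by move=> j /negbTE ->; rewrite mul0r.
Qed.

End TrigPolynomials.

Section Threshold.
Context {R : realType}.

(** With [r = s ^ 2], Bernoulli bounds [k s^k] by [1 / (1/s - 1)], and the remaining factor [s^k]
    tends to 0. *)
Lemma cvg_natM_expr (r : R) : 0 <= r < 1 -> k%:R * r ^+ k @[k --> \oo] --> 0.
Proof.
move=> /andP[r0 r1].
have [->|rn0] := eqVneq r 0.
  apply: cvg_near_cst; exists 1%N => // -[//|k] _.
  by rewrite exprS mul0r mulr0.
have {}r0 : 0 < r by rewrite lt_neqAle eq_sym rn0.
pose s := Num.sqrt r.
have s0 : 0 < s by rewrite sqrtr_gt0.
have s1 : s < 1 by rewrite -sqrtr1 ltr_sqrt.
pose c := s^-1 - 1.
have c0 : 0 < c by rewrite subr_gt0 invf_gt1.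
have kb k : k%:R * s ^+ k <= c^-1.
  have h : k%:R * c <= (s^-1) ^+ k.
    elim: k => [|k ih]; first by rewrite mul0r expr0.
    have s11 : 1 <= s^-1 by rewrite invf_ge1// ltW.
    have : 1 <= s^-1 ^+ k by rewrite exprn_ege1.
    move=> e1; rewrite exprS -natr1.
    have -> : s^-1 = 1 + c by rewrite /c addrC subrK.
    have -> : (1 + c) ^+ k = (s^-1) ^+ k by rewrite /c addrC subrK.
    nra.
  rewrite -ler_pdivlMr ?exprn_gt0// -exprVn ler_pdivlMl//.
  by rewrite mulrC.
apply: (@squeeze_cvgr _ _ _ _ (cst 0) (fun k => c^-1 * s ^+ k)).
- apply: nearW => k; rewrite /= mulr_ge0 ?exprn_ge0 ?(ltW r0)//=.
  have -> : r = s * s by rewrite -expr2 sqr_sqrtr ?ltW.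
  by rewrite exprMn mulrA ler_wpM2r// exprn_ge0// ltW.
- exact: cvg_cst.
- rewrite -[X in _ --> X](mulr0 c^-1); apply: cvgMl_tmp.
  by apply: cvg_expr; rewrite gtr0_norm.
Qed.


(** These polynomials in [T] approach a step at 1/2. Below 1/2, Bernoulli gives the lower bound
    [1 - k (2T)^k]; from 1/2 on, [(1 - y)^N <= 1 / (1 + N y)] with [y = 2^-k] gives the upper bound
    [1 / (k + 1)]. The factor [k] in the exponent is what forces the limit 0 at [T = 1/2] itself. *)
Lemma cvg_threshold (T : R) : 0 <= T <= 1 ->
  (1 - T ^+ k) ^+ (k * 2 ^ k)%N @[k --> \oo] --> ((T < 2^-1)%R%:R : R).
Proof.
move=> /andP[T0 T1].
have Tk1 k : T ^+ k <= 1 by rewrite exprn_ile1.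
have Tk0 k : 0 <= T ^+ k by rewrite exprn_ge0.
have [Th|Th] := ltP T 2^-1.
  apply: (@squeeze_cvgr _ _ _ _ (fun k => 1 - k%:R * (2 * T) ^+ k) (cst 1)).
  - apply: nearW => k; apply/andP; split; last first.
      by rewrite /= exprn_ile1// ?subr_ge0// lerBlDr lerDl.
    have h N (y : R) : 0 <= y <= 1 -> 1 - N%:R * y <= (1 - y) ^+ N.
      move=> /andP[y0 y1]; elim: N => [|N ih]; first by rewrite mul0r subr0 expr0.
      have N0 : 0 <= N%:R :> R by [].
      rewrite exprS -natr1; move: ih; set z := (1 - y) ^+ N; move=> ih.
      by apply: (@le_trans _ _ ((1 - y) * (1 - N%:R * y))); nra.
    apply: le_trans (h _ _ _); last by rewrite Tk0 Tk1.
    by rewrite natrM natrX exprMn mulrA.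
  - rewrite -[X in _ --> X](subr0 1); apply: cvgB; first exact: cvg_cst.
    apply: cvg_natM_expr; apply/andP; split; first by rewrite mulr_ge0.
    by rewrite mulrC -ltr_pdivlMr// div1r.
  - exact: cvg_cst.
apply: (@squeeze_cvgr _ _ _ _ (cst 0) (fun k => (k.+1%:R)^-1)).
- apply: nearW => k; apply/andP; split.
    by rewrite exprn_ge0// subr_ge0.
  have h N (y : R) : 0 <= y <= 1 -> (1 - y) ^+ N * (1 + N%:R * y) <= 1.
    move=> /andP[y0 y1]; elim: N => [|N ih]; first by rewrite mul0r addr0 expr0 mulr1.
    have N0 : 0 <= N%:R :> R by [].
    have z0 : 0 <= (1 - y) ^+ N by rewrite exprn_ge0// subr_ge0.
    rewrite exprS -natr1; move: ih z0; set z := (1 - y) ^+ N; move=> ih z0.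
    apply: le_trans ih; rewrite [(1 - y) * z]mulrC -mulrA ler_wpM2l//; nra.
  have y01 : 0 <= (2^-1 : R) ^+ k <= 1.
    by rewrite exprn_ge0//= exprn_ile1// invf_le1// ler1n.
  rewrite -[leRHS]mul1r ler_pdivlMr//.
  apply: le_trans (h (k * 2 ^ k)%N _ y01).
  rewrite natrM natrX -mulrA -exprMn divff// expr1n mulr1 nat1r.
  rewrite ler_wpM2r// lerXn2r ?nnegrE ?subr_ge0//; first by case/andP: y01.
  by rewrite lerB// lerXn2r// nnegrE.
- exact: cvg_cst.
- exact: cvg_harmonic.
Qed.

(** A trigonometric polynomial in [y] with values in [[0, 1]], as [cvg_threshold] requires, which is
    below 1/2 exactly where the sine is negative. *)
Definition sine_ramp (a x y : R) : R := (1 + sin (a * (y - x))) / 2.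

Lemma sine_ramp01 a x y : 0 <= sine_ramp a x y <= 1.
Proof.
rewrite /sine_ramp; have := sin_le1 (a * (y - x)).
have := sin_geN1 (a * (y - x)) => ? ?; apply/andP; split; lra.
Qed.

(* For [a] small the first zero of the sine beyond [x] lies past [y]. *)
Lemma cvg_sine_ramp x y :
  ((sine_ramp k.+1%:R^-1 x y < 2^-1)%R%:R : R) @[k --> \oo] --> ((y < x)%R%:R : R).
Proof.
apply: cvg_near_cst.
have ramp a : (sine_ramp a x y < 2^-1) = (sin (a * (y - x)) < 0).
  rewrite /sine_ramp; apply/idP/idP => ?; lra.
have [->|yx] := eqVneq y x.
  by apply: nearW => k; rewrite /sine_ramp subrr mulr0 sin0 addr0 div1r !ltxx.
have lim : k.+1%:R^-1 * `|y - x| @[k --> \oo] --> (0 : R).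
  rewrite -[X in _ --> X](mul0r `|y - x|); apply: cvgMr_tmp.
  exact: cvg_harmonic.
have : \forall k \near \oo, k.+1%:R^-1 * `|y - x| < pi.
  by apply: (cvgr_lt _ lim); exact: pi_gt0.
apply: filterS => k hk; rewrite ramp.
have [lt|gt|eq] := ltgtP y x; last by rewrite eq eqxx in yx.
- rewrite -[_ * _]opprK sinN oppr_lt0 sin_gt0_pi// -mulrN opprB.
  rewrite mulr_gt0 ?subr_gt0//=; move: hk.
  by rewrite ltr0_norm ?subr_lt0// opprB => ->.
- congr (nat_of_bool _)%:R; apply/negbTE; rewrite -leNgt; apply: sin_ge0_pi.
  move: hk; rewrite gtr0_norm ?subr_gt0// => /ltW ->.
  by rewrite mulr_ge0 ?subr_ge0 ?ltW.
Qed.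

End Threshold.

Lemma measurable_box {R : realType} {d : measure_display}
    {T : measurableType d} (n : nat) (W : 'I_n -> T -> R) (x : 'I_n -> R) :
  (forall i, measurable_fun setT (W i)) ->
  measurable [set w | forall i, W i w < x i].
Proof.
move=> mW; rewrite (_ : [set w | _] = \bigcap_i (W i @^-1` `]-oo, x i[)).
  apply: fin_bigcap_measurable => [|i _]; first exact: finite_finset.
  by rewrite -[X in measurable X]setTI; exact: mW.
apply/seteqP; split => w /= h i; first by rewrite /= in_itv/= => _; exact: h.
by have := h i I; rewrite /= in_itv.
Qed.

Section CosineTransform.
Context {R : realType}.
Context {d1 : measure_display} {T1 : measurableType d1}.
Context {d2 : measure_display} {T2 : measurableType d2}.
Variables (P1 : probability T1 R) (P2 : probability T2 R) (n : nat).
Variables (U : 'I_n -> T1 -> R) (V : 'I_n -> T2 -> R).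
Hypothesis mU : forall i, measurable_fun setT (U i).
Hypothesis mV : forall i, measurable_fun setT (V i).
Hypothesis UV : forall (u : 'I_n -> R) t,
  \int[P1]_w cos (\sum_i u i * U i w + t) =
  \int[P2]_w cos (\sum_i u i * V i w + t).

(** Measurability is bundled with the equality of expectations, so that the class is stable under
    bounded pointwise limits. *)
Let same (g : ('I_n -> R) -> R) : Prop :=
  [/\ measurable_fun setT (fun w => g (U ^~ w)),
      measurable_fun setT (fun w => g (V ^~ w)) &
      \int[P1]_w g (U ^~ w) = \int[P2]_w g (V ^~ w)].

Let measurable_lin d (T : measurableType d) (W : 'I_n -> T -> R)
  (u : 'I_n -> R) t : (forall i, measurable_fun setT (W i)) ->
  measurable_fun setT (fun w => \sum_i u i * W i w + t).
Proof.
move=> mW; apply: measurable_funD => //.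
by apply: measurable_sum => i; exact: measurable_funM.
Qed.

Let measurable_cos_lin d (T : measurableType d) (W : 'I_n -> T -> R)
  (u : 'I_n -> R) t : (forall i, measurable_fun setT (W i)) ->
  measurable_fun setT (fun w => cos (\sum_i u i * W i w + t)).
Proof.
move=> mW; apply: (measurableT_comp (continuous_measurable_fun (@continuous_cos R))).
exact: measurable_lin.
Qed.

Let trig_same g : trig_poly g -> same g /\ exists M, forall y, `|g y| <= M.
Proof.
elim => {g} [c u t|g h _ [[mg1 mg2 gE] [M gM]] _ [[mh1 mh2 hE] [N hN]]].
  split; last first.
    exists `|c| => y; rewrite normrM ler_piMr// ler_norml.
    by rewrite cos_geN1 cos_le1.
  split.
  - by apply: measurable_funM => //; exact: measurable_cos_lin.
  - by apply: measurable_funM => //; exact: measurable_cos_lin.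
  - have c1 (x : R) : `|cos x| <= 1 by rewrite ler_norml cos_geN1 cos_le1.
    rewrite !RintegralZl//; first by rewrite UV.
    + by apply: (@bounded_integrable _ _ _ _ _ 1) => //; exact: measurable_cos_lin.
    + by apply: (@bounded_integrable _ _ _ _ _ 1) => //; exact: measurable_cos_lin.
split; last first.
  exists (M + N) => y; rewrite (le_trans (ler_normD _ _))// lerD//.
split; [exact: measurable_funD|exact: measurable_funD|].
rewrite !RintegralD//; first by rewrite gE hE.
all: by apply: bounded_integrable => //.
Qed.

Let same_cvg (g_ : nat -> ('I_n -> R) -> R) g M : (forall k, same (g_ k)) ->
  (forall k y, `|g_ k y| <= M) -> (forall y, g_ k y @[k --> \oo] --> g y) ->
  same g.
Proof.
move=> sg gM gg.
have [m1 c1] := @bounded_cvg_Rintegral _ _ _ P1 (fun k w => g_ k (U ^~ w))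
  (fun w => g (U ^~ w)) M (fun k => let: And3 h _ _ := sg k in h)
  (fun k w => gM _ _) (fun w => gg _).
have [m2 c2] := @bounded_cvg_Rintegral _ _ _ P2 (fun k w => g_ k (V ^~ w))
  (fun w => g (V ^~ w)) M (fun k => let: And3 _ h _ := sg k in h)
  (fun k w => gM _ _) (fun w => gg _).
split => //.
apply: (@cvg_unique _ (@Rhausdorff R) _ _ _ _ c1).
rewrite (_ : (fun k => _) = (fun k => \int[P2]_w g_ k (V ^~ w))) //.
by apply/funext => k; case: (sg k).
Qed.

Let cvg_prod (g : nat -> 'I_n -> R) (l : 'I_n -> R) :
  (forall i, g k i @[k --> \oo] --> l i) ->
  \prod_i g k i @[k --> \oo] --> \prod_i l i.
Proof.
move=> gl; elim: (index_enum _) => [|i r ih].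
  by under eq_fun do rewrite big_nil; rewrite big_nil; exact: cvg_cst.
under eq_fun do rewrite big_cons.
by rewrite big_cons; apply: cvgM.
Qed.

Let norm_prod_le1 (g : 'I_n -> R) : (forall i, 0 <= g i <= 1) ->
  `|\prod_i g i| <= 1.
Proof.
move=> g01; rewrite ger0_norm; last by apply: prodr_ge0 => i _; case/andP: (g01 i).
by apply: prodr_ile1 => i _.
Qed.

(** Two successive bounded limits lead from trigonometric polynomials to the indicator of the box:
    the threshold turns each ramp into the indicator of a negative sine, then a frequency tending to
    0 turns the latter into the indicator of a half-line. *)
Lemma eq_cosine_transform_box (x : 'I_n -> R) :
  P1 [set w | forall i, U i w < x i] = P2 [set w | forall i, V i w < x i].
Proof.
have ramp a : same (fun y => \prod_i ((sine_ramp a (x i) (y i) < 2^-1)%R%:R : R)).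
  apply: (@same_cvg (fun k y =>
      \prod_i (1 - sine_ramp a (x i) (y i) ^+ k) ^+ (k * 2 ^ k)%N) _ 1).
  - move=> k; apply: (fun h => (trig_same h).1).
    apply: trig_poly_prod => i; apply: trig_polyX.
    (* The sine is a cosine with phase [- pi / 2], the form accepted by [trig_poly]. *)
    rewrite (_ : (fun y => _) = fun y => 1 +
       -1 * (2^-1 * (1 + cos (a * y i + (- (a * x i) - pi / 2)))) ^+ k).
      apply: trig_add; first exact: trig_poly_cst.
      apply: trig_polyM; first exact: trig_poly_cst.
      apply: trig_polyX; apply: trig_polyM; first exact: trig_poly_cst.
      apply: trig_add; first exact: trig_poly_cst.
      exact: trig_poly_coord.
    apply/funext => y; rewrite /sine_ramp addrA -mulrBr cosBpihalf.
    by rewrite mulN1r [in RHS]mulrC.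
  - move=> k y; apply: norm_prod_le1 => i.
    have /andP[s0 s1] := sine_ramp01 a (x i) (y i).
    have t0 : 0 <= 1 - sine_ramp a (x i) (y i) ^+ k.
      by rewrite subr_ge0 exprn_ile1.
    by rewrite exprn_ge0//= exprn_ile1// lerBlDr lerDl exprn_ge0.
  - by move=> y; apply: cvg_prod => i; apply: cvg_threshold; exact: sine_ramp01.
have [m1 m2 E] : same (fun y => \prod_i ((y i < x i)%R%:R : R)).
  apply: (@same_cvg (fun k y =>
      \prod_i ((sine_ramp k.+1%:R^-1 (x i) (y i) < 2^-1)%R%:R : R)) _ 1).
  - by move=> k; exact: ramp.
  - by move=> k y; apply: norm_prod_le1 => i; case: (_ < _); rewrite /= ?ler01 ?lexx.
  - by move=> y; apply: cvg_prod => i; exact: cvg_sine_ramp.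
have boxE d (T : measurableType d) (P : probability T R) (W : 'I_n -> T -> R) :
    (forall i, measurable_fun setT (W i)) ->
    (\int[P]_w \prod_i ((W i w < x i)%R%:R : R))%:E =
    P [set w | forall i, W i w < x i].
  move=> mW.
  have mB := measurable_box x mW.
  rewrite (_ : (fun w => _) = \1_[set w | forall i, W i w < x i]).
    rewrite /Rintegral integral_indic// setIT fineK//.
    by rewrite fin_num_measure.
  apply/funext => w; rewrite indicE.
  case: (boolP (w \in _)) => [|] /=.
    rewrite inE /= => h; rewrite big1// => i _; by rewrite h.
  move=> /negP h; move: h; rewrite inE/= => /existsNP[i].
  move=> /negP hi; rewrite (bigD1 i)//= (negbTE hi) mul0r//.
by rewrite -boxE// -boxE// E.
Qed.

End CosineTransform.

(** * The normal law *)

Section NormalLaw.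
Context {R : realType}.
Local Notation mu := (@lebesgue_measure R).
Implicit Types (m s x : R).

(** [normal_pdf] and the Radon-Nikodym derivative have the same integral over every measurable set,
    hence agree almost everywhere. Nonnegative integrands come first because they yield the
    integrability of [g]. *)
Lemma normal_prob_integrable m s (g : R -> R) : measurable_fun setT g ->
  mu.-integrable setT (fun x => (g x * normal_pdf m s x)%:E) ->
  (normal_prob m s).-integrable setT (EFin \o g) /\
  \int[normal_prob m s]_x g x = \int[mu]_x (g x * normal_pdf m s x).
Proof.
move=> mg ig.
have dom := @normal_prob_dominates R m s.
pose h := Radon_Nikodym_SigmaFinite.f (normal_prob m s) mu.
have hE : ae_eq mu setT h (fun x => (normal_pdf m s x)%:E).
  apply: integral_ae_eq => //.
  - exact: Radon_Nikodym_SigmaFinite.f_integrable.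
  - by apply/measurable_EFinP; exact: measurable_normal_pdf.
  - by move=> E _ mE; rewrite -Radon_Nikodym_SigmaFinite.f_integral.
have ge0E (k : R -> R) : (forall x, 0 <= k x) -> measurable_fun setT k ->
    (\int[normal_prob m s]_x (k x)%:E =
     \int[mu]_x (k x * normal_pdf m s x)%:E)%E.
  move=> k0 mk; rewrite -(Radon_Nikodym_SigmaFinite.change_of_variables dom)//.
  - apply: ae_eq_integral => //.
    + apply: emeasurable_funM; first exact/measurable_EFinP.
      exact: measurable_int (Radon_Nikodym_SigmaFinite.f_integrable dom).
    + apply/measurable_EFinP/measurable_funM => //; exact: measurable_normal_pdf.
    + by under [X in ae_eq _ _ _ X]eq_fun do rewrite EFinM; exact: ae_eqe_mul2l.
  - exact/measurable_EFinP.
have igN : (normal_prob m s).-integrable setT (EFin \o g).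
  apply/integrableP; split; first exact/measurable_EFinP.
  rewrite (ge0E (fun x => `|g x|))//; last exact: measurableT_comp.
  case/integrableP : ig => _; congr (_ < _)%E; apply: eq_integral => x _ /=.
  by rewrite normrM (ger0_norm (normal_pdf_ge0 _ _ _)).
split=> //.
rewrite /Rintegral -(Radon_Nikodym_change_of_variables dom)//; congr fine.
apply: ae_eq_integral => //.
- apply: emeasurable_funM; first exact/measurable_EFinP.
  exact: measurable_int (Radon_Nikodym_integrable _).
- exact: measurable_int ig.
under [X in ae_eq _ _ _ X]eq_fun do rewrite EFinM; apply: ae_eqe_mul2l.
apply: ae_eq_trans hE; apply: ae_eq_sym.
exact: ae_eq_Radon_Nikodym_SigmaFinite.
Qed.

(* Fundamental theorem of calculus on the whole line for a primitive that
   decays like [1 / x]. *)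
Lemma Rintegral_derive_eq0 (F g : R -> R) m (C : R) :
  continuous g -> mu.-integrable setT (EFin \o g) ->
  (forall x, is_derive x 1 F (g x)) -> (forall x, `|F x| * `|x - m| <= C) ->
  \int[mu]_x g x = 0.
Proof.
move=> cg ig Fg FC.
have mg : measurable_fun setT g by exact: continuous_measurable_fun.
pose k (n : nat) : R := n.+1%:R.
have k0 n : 0 < k n by [].
pose D n := `[m - k n, m + k n]%classic.
have E n : \int[mu]_x (g \_ (D n)) x = F (m + k n) - F (m - k n).
  rewrite -Rintegral_mkcond /Rintegral.
  rewrite (@continuous_FTC2 _ g F)//.
  - by have := k0 n; lra.
  - exact: continuous_subspaceT.
  - have cF x : F @ x --> F x.
      apply: differentiable_continuous; apply/derivable1_diffP.
      by apply: ex_derive.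
    split; first by move=> x _; exact: ex_derive.
      by apply: cvg_at_right_filter; exact: cF.
    by apply: cvg_at_left_filter; exact: cF.
  - by move=> x _; rewrite derive1E derive_val.
have L0 : \int[mu]_x (g \_ (D n)) x @[n --> \oo] --> (0 : R).
  apply: norm_cvg0.
  apply: (@squeeze_cvgr _ _ _ _ (cst 0) (fun n => (C + C) * (k n)^-1)).
  - apply: nearW => n; rewrite normr_ge0/= E.
    have h1 : `|F (m + k n)| <= C * (k n)^-1.
      rewrite ler_pdivlMr ?k0//; have := FC (m + k n).
      by rewrite addrAC subrr add0r (gtr0_norm (k0 n)).
    have h2 : `|F (m - k n)| <= C * (k n)^-1.
      rewrite ler_pdivlMr ?k0//; have := FC (m - k n).
      by rewrite addrAC subrr add0r normrN (gtr0_norm (k0 n)).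
    by rewrite mulrDl (le_trans (ler_normB _ _))// lerD.
  - exact: cvg_cst.
  - rewrite -[X in _ --> X](mulr0 (C + C)); apply: cvgMl_tmp.
    exact: cvg_harmonic.
have L1 : \int[mu]_x (g \_ (D n)) x @[n --> \oo] --> \int[mu]_x g x.
  have mD n : measurable_fun setT (g \_ (D n)).
    have h : measurable_fun (D n) g by exact: measurable_funTS.
    exact: (measurable_restrictT g (measurable_itv `[m - k n, m + k n])).1 h.
  have [|||||] := @dominated_convergence _ _ _ mu setT measurableT
    (fun n => EFin \o (g \_ (D n))) (EFin \o g) (fun x => `|g x|%:E).
  - by move=> n; apply/measurable_EFinP; exact: mD.
  - exact/measurable_EFinP.
  - apply: aeW => x _; apply: cvg_near_cst.
    near=> n.
    rewrite /= patchE mem_set// /D/= in_itv/= -ler_distl /k -nat1r -lerBlDl.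
    by near: n; exact: nbhs_infty_ger.
  - move/integrable_abse: ig => /=; exact.
  - apply: aeW => x n _ /=; rewrite lee_fin patchE.
    by case: ifP => // _; rewrite normr0.
  move=> _ _ /= h; apply: fine_cvg.
  by rewrite fineK//; exact: integrable_fin_num.
exact: (@cvg_unique _ (@Rhausdorff R) _ _ _ _ L1 L0).
Unshelve. all: by end_near. Qed.

Lemma is_derive_normal_pdf m s x (s0 : s != 0) :
  is_derive x 1 (normal_pdf m s) (- (x - m) / s ^+ 2 * normal_pdf m s x).
Proof.
rewrite normal_pdfE// /normal_fun; apply: is_derive_eq.
by rewrite /GRing.scale/=; field.
Qed.

(** Domination by a wider normal density gives at once the integrability of the second moment and a
    uniform bound, which controls boundary terms. *)
Lemma normal_pdf_sqr_le m s : 0 < s -> exists2 C : R, 0 <= C & forall x,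
  (x - m) ^+ 2 * normal_pdf m s x <= C * normal_pdf m (2 * s) x.
Proof.
move=> s0.
have p0 : 0 < normal_peak s by rewrite normal_peak_gt0 ?gt_eqF.
have p20 : 0 < normal_peak (2 * s) by rewrite normal_peak_gt0 ?gt_eqF ?mulr_gt0.
exists (s ^+ 2 * 3 * normal_peak s / normal_peak (2 * s)).
  by rewrite divr_ge0 ?ltW// mulr_gt0// mulr_gt0// exprn_gt0.
move=> x; rewrite !normal_pdfE ?gt_eqF ?mulr_gt0// /normal_fun.
set y := (x - m) ^+ 2 / s ^+ 2.
(* The part [y / 8] of the exponent belongs to the density of deviation [2 * s]; the rest,
   [3 / 8 * y], absorbs the factor [y] through [1 + x <= expR x]. *)
have -> : - (x - m) ^+ 2 / (s ^+ 2 *+ 2) = - (3 / 8 * y) - y / 8.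
  by rewrite /y; field; rewrite gt_eqF.
have -> : - (x - m) ^+ 2 / ((2 * s) ^+ 2 *+ 2) = - y / 8.
  by rewrite /y; field; rewrite gt_eqF.
have -> : (x - m) ^+ 2 = s ^+ 2 * y by rewrite /y; field; rewrite gt_eqF.
have y0 : 0 <= y by rewrite divr_ge0 ?sqr_ge0.
have h : y * expR (- (3 / 8 * y)) <= 3.
  rewrite expRN ler_pdivrMr ?expR_gt0//.
  by have := expR_ge1Dx (3 / 8 * y); lra.
rewrite expRD mulNr.
have -> : s ^+ 2 * y * (normal_peak s * (expR (- (3 / 8 * y)) * expR (- (y / 8)))) =
  (y * expR (- (3 / 8 * y))) * (s ^+ 2 * normal_peak s * expR (- (y / 8))) by ring.
have -> : s ^+ 2 * 3 * normal_peak s / normal_peak (2 * s) *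
    (normal_peak (2 * s) * expR (- (y / 8))) =
    3 * (s ^+ 2 * normal_peak s * expR (- (y / 8))).
  by field; rewrite gt_eqF.
rewrite ler_wpM2r// mulr_ge0 ?expR_ge0// mulr_ge0 ?sqr_ge0 ?ltW//.
Qed.


Let ler_mul_oneDsqr (a b : R) : 0 <= b -> a * b <= b + a ^+ 2 * b.
Proof.
move=> b0; rewrite -subr_ge0.
have -> : b + a ^+ 2 * b - a * b = b * ((a - 2^-1) ^+ 2 + 3 / 4) by field.
by rewrite mulr_ge0// addr_ge0 ?sqr_ge0.
Qed.

Section Moments.
Variables (m s : R).
Hypothesis s0 : 0 < s.
Let sn0 : s != 0. Proof. by rewrite gt_eqF. Qed.
Local Notation p := (normal_pdf m s).

Let cp : continuous p. Proof. exact: continuous_normal_pdf. Qed.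

Lemma normal_pdf_sqr_integrable :
  mu.-integrable setT (fun x => ((x - m) ^+ 2 * p x)%:E).
Proof.
have [C C0 pC] := normal_pdf_sqr_le m s0.
apply: (le_integrable measurableT _ _
  (integrableZl measurableT C (integrable_normal_pdf m (2 * s)))).
- apply/measurable_EFinP/measurable_funM; last exact: measurable_normal_pdf.
  by apply: measurable_funX; exact: measurable_funB.
- move=> x _; rewrite -EFinM !abse_EFin lee_fin.
  rewrite ger0_norm; last by rewrite mulr_ge0 ?sqr_ge0 ?normal_pdf_ge0.
  by rewrite ger0_norm// mulr_ge0 ?normal_pdf_ge0.
Qed.

Lemma normal_pdf_dist_integrable :
  mu.-integrable setT (fun x => ((x - m) * p x)%:E).
Proof.
apply: (le_integrable measurableT _ _
  (integrableD measurableT (integrable_normal_pdf m s) normal_pdf_sqr_integrable)).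
- apply/measurable_EFinP/measurable_funM; last exact: measurable_normal_pdf.
  exact: measurable_funB.
- move=> x _; rewrite /= lee_fin.
  have p0 := normal_pdf_ge0 m s x.
  rewrite normrM (ger0_norm p0) [leRHS]ger0_norm; last first.
    by rewrite addr_ge0// mulr_ge0 ?sqr_ge0.
  rewrite -[_ ^+ 2]real_normK ?num_real//.
  move: p0; set a := `|x - m|; set b := p x; move=> b0.
  exact: ler_mul_oneDsqr.
Qed.

Lemma normal_pdf_sqr_bounded : exists C : R, forall x, (x - m) ^+ 2 * p x <= C.
Proof.
have [C C0 pC] := normal_pdf_sqr_le m s0.
exists (C * normal_peak (2 * s)) => x; rewrite (le_trans (pC x))// ler_wpM2l//.
by rewrite normal_pdf_ub// gt_eqF// mulr_gt0.
Qed.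

Lemma Rintegral_normal_pdf : \int[mu]_x p x = 1.
Proof. by rewrite /Rintegral integral_normal_pdf. Qed.

Lemma normal_prob_mean : (normal_prob m s).-integrable setT (fun x => x%:E) /\
  \int[normal_prob m s]_x x = m.
Proof.
have iE : mu.-integrable setT (fun x => (x * p x)%:E).
  have := integrableD measurableT normal_pdf_dist_integrable
    (integrableZl measurableT m (integrable_normal_pdf m s)).
  apply: eq_integrable => // x _ /=.
  by rewrite -EFinM -EFinD; congr EFin; ring.
have [i ->] := normal_prob_integrable (@measurable_id _ R setT) iE.
split=> //.
have h : \int[mu]_x ((x - m) * p x) = 0.
  have [C pC] := normal_pdf_sqr_bounded.
  (* The decay constant comes from [a <= 1 + a ^ 2], which bounds [|x - m| * p x] by the peak plus
     the bound [C] on [(x - m) ^+ 2 * p x]. *)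
  apply: (@Rintegral_derive_eq0 (fun x => - s ^+ 2 * p x)
    (fun x => (x - m) * p x) m (s ^+ 2 * (normal_peak s + C))).
  - by move=> x; apply: cvgM; [apply: cvgB; [exact: cvg_id|exact: cvg_cst]|exact: cp].
  - exact: normal_pdf_dist_integrable.
  - move=> x; have := @is_derive_normal_pdf m s x sn0 => h.
    by apply: is_derive_eq; rewrite /GRing.scale/=; field.
  - move=> x; have p0 := normal_pdf_ge0 m s x; have := pC x => hC.
    have ub := normal_pdf_ub m x sn0.
    rewrite normrM normrN (ger0_norm (sqr_ge0 _)) (ger0_norm p0) -mulrA.
    rewrite ler_wpM2l ?sqr_ge0//.
    move: hC; rewrite -real_normK ?num_real//.
    have := normr_ge0 (x - m); set a := `|x - m|; move=> a0 hC.
    by rewrite mulrC (le_trans (ler_mul_oneDsqr a p0))// lerD.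
have -> : \int[mu]_x (x * p x) = \int[mu]_x ((x - m) * p x + m * p x).
  by apply: eq_Rintegral => x _; ring.
rewrite RintegralD//; first last.
- have := integrableZl measurableT m (integrable_normal_pdf m s); by apply: eq_integrable.
- exact: normal_pdf_dist_integrable.
rewrite h RintegralZl//; last exact: integrable_normal_pdf.
by rewrite Rintegral_normal_pdf mulr1 add0r.
Qed.

Lemma normal_prob_sqr :
  (normal_prob m s).-integrable setT (fun x => ((x - m) ^+ 2)%:E) /\
  \int[normal_prob m s]_x (x - m) ^+ 2 = s ^+ 2.
Proof.
have mf : measurable_fun setT (fun x : R => (x - m) ^+ 2).
  by apply: measurable_funX; exact: measurable_funB.
have [i ->] := normal_prob_integrable mf normal_pdf_sqr_integrable.
split=> //.
have ip : mu.-integrable setT (fun x => (s ^+ 2 * p x)%:E).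
  have := integrableZl measurableT (s ^+ 2)
    (integrable_normal_pdf m s); by apply: eq_integrable.
have h : \int[mu]_x ((x - m) ^+ 2 * p x - s ^+ 2 * p x) = 0.
  have [C pC] := normal_pdf_sqr_bounded.
  apply: (@Rintegral_derive_eq0 (fun x => - s ^+ 2 * ((x - m) * p x))
    (fun x => (x - m) ^+ 2 * p x - s ^+ 2 * p x) m (s ^+ 2 * C)).
  - move=> x; apply: cvgB; apply: cvgM; [|exact: cp|exact: cvg_cst|exact: cp].
    apply: (@continuous_comp _ _ _ (fun x => x - m) (fun y => y ^+ 2)).
      by apply: cvgB; [exact: cvg_id|exact: cvg_cst].
    exact: exprn_continuous.
  - have := integrableB measurableT normal_pdf_sqr_integrable ip.
    by apply: eq_integrable.
  - move=> x; have := @is_derive_normal_pdf m s x sn0 => h.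
    by apply: is_derive_eq; rewrite /GRing.scale/=; field.
  - move=> x; have p0 := normal_pdf_ge0 m s x.
    rewrite !normrM normrN (ger0_norm (sqr_ge0 _)) (ger0_norm p0) -mulrA.
    rewrite ler_wpM2l ?sqr_ge0//.
    by rewrite mulrAC -expr2 real_normK ?num_real.
move: h; rewrite RintegralB//; last exact: normal_pdf_sqr_integrable.
rewrite RintegralZl//; last exact: integrable_normal_pdf.
by rewrite Rintegral_normal_pdf mulr1 => /subr0_eq.
Qed.

End Moments.

Section CosineTransformNormal.
Variable s : R.
Hypothesis s0 : 0 < s.
Let sn0 : s != 0. Proof. by rewrite gt_eqF. Qed.
Local Notation p := (normal_pdf 0 s).
Let cp : continuous p. Proof. exact: continuous_normal_pdf. Qed.

Let phi th t := \int[mu]_x (cos (t * x + th) * p x).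

Let pdf_integrableM (g : R -> R) : continuous g -> (forall x, `|g x| <= 1) ->
  mu.-integrable setT (fun x => (g x * p x)%:E) /\
  mu.-integrable setT (fun x => (x * g x * p x)%:E).
Proof.
move=> cg g1; have mg : measurable_fun setT g by exact: continuous_measurable_fun.
split.
- apply: (le_integrable measurableT _ _ (integrable_normal_pdf 0 s)).
    apply/measurable_EFinP/measurable_funM => //; exact: measurable_normal_pdf.
  move=> x _; rewrite !abse_EFin lee_fin normrM ler_piMl//.
- apply: (le_integrable measurableT _ _ (normal_pdf_dist_integrable 0 s0)).
    apply/measurable_EFinP/measurable_funM; last exact: measurable_normal_pdf.
    exact: measurable_funM.
  move=> x _; rewrite !abse_EFin lee_fin subr0 !normrM ler_wpM2r//.
  by rewrite ler_piMr.
Qed.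

Let c_lin t th : continuous (fun x : R => t * x + th).
Proof.
move=> x; apply: cvgD; last exact: cvg_cst.
by apply: cvgM; [exact: cvg_cst|exact: cvg_id].
Qed.

Let ccos t th : continuous (fun x : R => cos (t * x + th)).
Proof.
move=> x; apply: (@continuous_comp _ _ _ (fun x => t * x + th) cos).
  exact: c_lin.
exact: continuous_cos.
Qed.

Let csin t th : continuous (fun x : R => sin (t * x + th)).
Proof.
move=> x; apply: (@continuous_comp _ _ _ (fun x => t * x + th) sin).
  exact: c_lin.
exact: continuous_sin.
Qed.

Let cos1 (x : R) : `|cos x| <= 1. Proof. by rewrite ler_norml cos_geN1 cos_le1. Qed.
Let sin1 (x : R) : `|sin x| <= 1. Proof. by rewrite ler_norml sin_geN1 sin_le1. Qed.

(** Stein's identity, an integration by parts with [- s ^+ 2 * (sin (t * x + th) * p x)]; it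
    expresses the derivative of [phi th] as a multiple of [phi th]. *)
Let stein th t : \int[mu]_x (x * sin (t * x + th) * p x) = s ^+ 2 * t * phi th t.
Proof.
have [ic _] := pdf_integrableM (@ccos t th) (fun x => cos1 _).
have [_ is_] := pdf_integrableM (@csin t th) (fun x => sin1 _).
have ic' : mu.-integrable setT (fun x => (s ^+ 2 * t * (cos (t * x + th) * p x))%:E).
  by have := integrableZl measurableT (s ^+ 2 * t) ic; apply: eq_integrable.
have h : \int[mu]_x (x * sin (t * x + th) * p x
    - s ^+ 2 * t * (cos (t * x + th) * p x)) = 0.
  have [C pC] := normal_pdf_sqr_bounded 0 s0.
  apply: (@Rintegral_derive_eq0 (fun x => - s ^+ 2 * (sin (t * x + th) * p x))
    (fun x => x * sin (t * x + th) * p x - s ^+ 2 * t * (cos (t * x + th) * p x))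
    0 (s ^+ 2 * (normal_peak s + C))).
  - move=> x; apply: cvgB; apply: cvgM; [|exact: cp|exact: cvg_cst|].
      by apply: cvgM; [exact: cvg_id|exact: csin].
    by apply: cvgM; [exact: ccos|exact: cp].
  - have := integrableB measurableT is_ ic'.
    by apply: eq_integrable.
  - move=> x; have := @is_derive_normal_pdf 0 s x sn0 => h.
    by apply: is_derive_eq; rewrite /GRing.scale/=; field.
  - move=> x; have p0 := normal_pdf_ge0 0 s x; have := pC x => hC.
    have ub := normal_pdf_ub 0 x sn0.
    rewrite normrM normrN (ger0_norm (sqr_ge0 _)) -mulrA ler_wpM2l ?sqr_ge0//.
    rewrite normrM (ger0_norm p0); move: hC; rewrite -real_normK ?num_real//.
    have := sin1 (t * x + th) => hs hC.
    have hA : p x * `|x - 0| <= normal_peak s + C.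
      move: hC; have := normr_ge0 (x - 0); set a := `|x - 0|; move=> a0 hC.
      by rewrite mulrC (le_trans (ler_mul_oneDsqr a p0))// lerD.
    by rewrite -mulrA; apply: le_trans hA; rewrite ler_piMl// mulr_ge0.
move: h; rewrite RintegralB// => /subr0_eq ->.
by rewrite RintegralZl.
Qed.

Let derive_phi (th t : R) : is_derive t 1 (phi th) (- (s ^+ 2 * t * phi th t)).
Proof.
have It : (`]t - 1, t + 1[%classic : set R) t.
  by rewrite /= in_itv/=; apply/andP; split; lra.
pose f (u x : R) := cos (u * x + th) * p x.
have df (u x : R) : is_derive u 1 (f ^~ x) (- (x * sin (u * x + th) * p x)).
  by apply: is_derive_eq; rewrite /GRing.scale/=; ring.
have d1 u x : partial1of2 f u x = - (x * sin (u * x + th) * p x).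
  by rewrite partial1of2E derive_val.
have iG : mu.-integrable setT (EFin \o (fun x => `|x| * p x)).
  have := integrable_abse (normal_pdf_dist_integrable 0 s0).
  apply: eq_integrable => // x _ /=.
  by rewrite subr0 normrM (ger0_norm (normal_pdf_ge0 _ _ _)).
have if_ u : mu.-integrable setT (EFin \o f u).
  by have [] := pdf_integrableM (@ccos u th) (fun x => cos1 _).
have G0 x : setT x -> 0 <= `|x| * p x by rewrite mulr_ge0 ?normal_pdf_ge0.
have bG u x : (`]t - 1, t + 1[%classic : set R) u -> setT x ->
    `|partial1of2 f u x| <= `|x| * p x.
  move=> _ _; rewrite d1 normrN !normrM (ger0_norm (normal_pdf_ge0 _ _ _)).
  by rewrite ler_wpM2r ?normal_pdf_ge0// ler_piMr.
have dd u x : (`]t - 1, t + 1[%classic : set R) u -> setT x -> derivable (f ^~ x) u 1.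
  by move=> _ _; exact: ex_derive.
apply: DeriveDef.
  exact: (derivable_under_integral measurableT It (fun u _ => if_ u) dd (fun x => G0 x I) iG bG).
rewrite -derive1E.
rewrite (differentiation_under_integral measurableT It (fun u _ => if_ u) dd (fun x => G0 x I) iG bG).
rewrite -stein -[RHS]mulN1r -RintegralZl//; last first.
  by have [] := pdf_integrableM (@csin t th) (fun x => sin1 _).
by apply: eq_Rintegral => x _; rewrite d1 mulN1r.
Qed.

Lemma normal_prob_cos t th :
  \int[normal_prob 0 s]_x cos (t * x + th) = cos th * expR (- (s * t) ^+ 2 / 2).
Proof.
have [ic _] := pdf_integrableM (@ccos t th) (fun x => cos1 _).
have [_ ->] := normal_prob_integrable (continuous_measurable_fun (@ccos t th)) ic.
rewrite -/(phi th t).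
(* The equation [phi' = - s^2 u phi] makes this product constant; its value at 0 is [cos th]. *)
have d (u : R) : is_derive u 1 (fun u => phi th u * expR ((s * u) ^+ 2 / 2)) 0.
  have := derive_phi th u => h.
  by apply: is_derive_eq; rewrite /GRing.scale/=; field.
have : phi th t * expR ((s * t) ^+ 2 / 2) = phi th 0 * expR ((s * 0) ^+ 2 / 2).
  exact: (is_derive_0_is_cst (f := fun u => phi th u * expR ((s * u) ^+ 2 / 2))).
rewrite mulr0 expr0n/= mul0r expR0 mulr1.
have -> : phi th 0 = cos th.
  rewrite /phi; under eq_Rintegral do rewrite mul0r add0r.
  rewrite RintegralZl//; last exact: integrable_normal_pdf.
  by rewrite Rintegral_normal_pdf mulr1.
by move=> <-; rewrite -mulrA -expRD mulNr subrr expR0 mulr1.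
Qed.

End CosineTransformNormal.

(** By evenness the integral is twice that over the half-line, where [- s ^+ 2 * normal_pdf 0 s] is
    a primitive vanishing at infinity. *)
Lemma normal_prob_abs s : 0 < s ->
  (normal_prob 0 s).-integrable setT (fun x => `|x|%:E) /\
  \int[normal_prob 0 s]_x `|x| = 2 * s ^+ 2 * normal_peak s.
Proof.
move=> s0; have sn0 : s != 0 by rewrite gt_eqF.
have ie : mu.-integrable setT (fun x => (`|x| * normal_pdf 0 s x)%:E).
  have := integrable_abse (normal_pdf_dist_integrable 0 s0).
  apply: eq_integrable => // x _ /=.
  by rewrite subr0 normrM (ger0_norm (normal_pdf_ge0 _ _ _)).
have mn : measurable_fun setT (fun x : R => `|x|) by exact: measurableT_comp.
have [i ->] := normal_prob_integrable mn ie.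
split=> //.
have cp := @continuous_normal_pdf _ 0 s sn0.
have cf : continuous (fun x => `|x| * normal_pdf 0 s x).
  by move=> x; apply: cvgM; [exact: norm_continuous|exact: cp].
have pN x : normal_pdf 0 s (- x) = normal_pdf 0 s x.
  by rewrite !normal_pdfE// /normal_fun !subr0 sqrrN.
rewrite /Rintegral ge0_symfun_integralT//; first last.
- by move=> x /=; rewrite normrN pN.
- by move=> x; rewrite mulr_ge0 ?normal_pdf_ge0.
have [C pC] := normal_pdf_sqr_bounded 0 s0.
have F0 : (fun x => - s ^+ 2 * normal_pdf 0 s x) x @[x --> +oo] --> (0 : R).
  rewrite -[X in _ --> X](mulr0 (- s ^+ 2)); apply: cvgMl_tmp.
  apply: (@squeeze_cvgr _ _ _ _ (cst 0) (fun x => (normal_peak s + C) * x^-1)).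
  - near=> x; rewrite /= normal_pdf_ge0/=.
    have x0 : 0 < x by near: x; exact: nbhs_pinfty_gt.
    rewrite ler_pdivlMr// mulrC.
    apply: le_trans (ler_mul_oneDsqr _ (normal_pdf_ge0 0 s x)) _.
    by rewrite lerD ?normal_pdf_ub//; have := pC x; rewrite subr0.
  - exact: cvg_cst.
  - rewrite -[X in _ --> X](mulr0 (normal_peak s + C)); apply: cvgMl_tmp.
    apply/(gtr0_cvgV0 (f := fun x : R => x)); [exact: nbhs_pinfty_gt|exact: cvg_id].
have dF (x : R) : is_derive x 1 (fun x => - s ^+ 2 * normal_pdf 0 s x)
    (x * normal_pdf 0 s x).
  have h := is_derive_normal_pdf 0 x sn0.
  by apply: is_derive_eq; rewrite /GRing.scale/=; field.
rewrite -set_itvcy.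
have -> : (\int[mu]_(x in `[0%R, +oo[) (`|x| * normal_pdf 0 s x)%:E =
    \int[mu]_(x in `[0%R, +oo[) (x * normal_pdf 0 s x)%:E)%E.
  apply: eq_integral => x; by rewrite inE/= in_itv/= andbT => x0; rewrite ger0_norm.
rewrite (ge0_continuous_FTC2y _ _ F0)//.
- rewrite sub0e -EFinN -EFinM/=.
  rewrite normal_pdfE// /normal_fun subrr expr0n/= oppr0 mul0r expR0.
  by ring.
- by move=> x x0; rewrite mulr_ge0 ?normal_pdf_ge0.
- apply: continuous_subspaceT => x.
  by apply: cvgM; [exact: cvg_id|exact: cp].
- apply: cvg_at_right_filter; apply: cvgM; first exact: cvg_cst.
  exact: cp.
- by move=> x _; rewrite derive1E derive_val.
Unshelve. all: by end_near. Qed.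

End NormalLaw.

(** * Gaussian processes and regression *)

Section SquareIntegrable.
Context {d : measure_display} {Omega : measurableType d} {R : realType}.
Variable P : probability Omega R.
Implicit Types U V : Omega -> R.

Definition sq_integrable U :=
  measurable_fun setT U /\ P.-integrable setT (fun w => (U w ^+ 2)%:E).

Lemma sq_integrableM U V : sq_integrable U -> sq_integrable V ->
  P.-integrable setT (fun w => (U w * V w)%:E).
Proof.
move=> [mU iU] [mV iV].
apply: (le_integrable measurableT _ _ (integrableD measurableT iU iV)).
  by apply/measurable_EFinP; exact: measurable_funM.
move=> w _; rewrite /= lee_fin [leRHS]ger0_norm ?addr_ge0 ?sqr_ge0//.
rewrite normrM -(real_normK (num_real (U w))) -(real_normK (num_real (V w))).
by have := sqr_ge0 (`|U w| - `|V w|); nra.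
Qed.

Lemma sq_integrable_cst c : sq_integrable (fun=> c).
Proof.
split=> //.
apply: (@bounded_integrable _ _ _ P (fun=> c ^+ 2) `|c ^+ 2|) => //.
Qed.

Lemma sq_integrable_integrable U : sq_integrable U ->
  P.-integrable setT (EFin \o U).
Proof.
move=> /sq_integrableM /(_ (sq_integrable_cst 1)).
by apply: eq_integrable => // w _ /=; rewrite mulr1.
Qed.

Lemma sq_integrableZ c U : sq_integrable U -> sq_integrable (fun w => c * U w).
Proof.
move=> [mU iU]; split; first exact: measurable_funM.
have := integrableZl measurableT (c ^+ 2) iU.
by apply: eq_integrable => // w _ /=; rewrite exprMn.
Qed.

Lemma sq_integrableD U V : sq_integrable U -> sq_integrable V ->
  sq_integrable (fun w => U w + V w).
Proof.
move=> qU qV; split; first by apply: measurable_funD; [case: qU|case: qV].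
have iUV := integrableZl measurableT 2 (sq_integrableM qU qV).
have := integrableD measurableT (integrableD measurableT qU.2 iUV) qV.2.
apply: eq_integrable => // w _ /=.
by rewrite -!EFinM -!EFinD; congr EFin; ring.
Qed.

Lemma sq_integrable_sum (I : Type) (r : seq I) (F : I -> Omega -> R) :
  (forall i, sq_integrable (F i)) ->
  sq_integrable (fun w => \sum_(i <- r) F i w).
Proof.
move=> qF; elim: r => [|i r ih].
  rewrite (_ : (fun w => _) = fun=> 0); first exact: sq_integrable_cst.
  by apply/funext => w; rewrite big_nil.
rewrite (_ : (fun w => _) = fun w => F i w + \sum_(j <- r) F j w).
  exact: sq_integrableD.
by apply/funext => w; rewrite big_cons.
Qed.

Lemma Rintegral_sum (I : Type) (r : seq I) (F : I -> Omega -> R) :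
  (forall i, P.-integrable setT (EFin \o F i)) ->
  \int[P]_w (\sum_(i <- r) F i w) = \sum_(i <- r) \int[P]_w F i w.
Proof.
move=> iF.
have : P.-integrable setT (EFin \o (fun w => \sum_(i <- r) F i w)) /\
    \int[P]_w (\sum_(i <- r) F i w) = \sum_(i <- r) \int[P]_w F i w.
  elim: r => [|i r [ih1 ih2]].
    rewrite big_nil (_ : (fun w => _) = fun=> 0); last first.
      by apply/funext => w; rewrite big_nil.
    by split; [exact: integrable0|rewrite /Rintegral integral0].
  rewrite big_cons (_ : (fun w => _) = fun w => F i w + \sum_(j <- r) F j w); last first.
    by apply/funext => w; rewrite big_cons.
  split; last by rewrite RintegralD// ih2.
  by have := integrableD measurableT (iF i) ih1; apply: eq_integrable.
by case.
Qed.

End SquareIntegrable.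

Section CenteredGaussian.
Context {d : measure_display} {Omega : measurableType d} {R : realType}.
Variable P : probability Omega R.

Lemma integral_law (U : Omega -> measurableTypeR R)
    (nu : {measure set (measurableTypeR R) -> \bar R})
    (g : measurableTypeR R -> R) : measurable_fun setT U ->
  (forall A, measurable A -> P (U @^-1` A) = nu A) ->
  measurable_fun setT g -> P.-integrable setT (fun w => (g (U w))%:E) ->
  \int[P]_w g (U w) = \int[nu]_x g x.
Proof.
move=> mU Unu mg ig; rewrite /Rintegral.
have mg' : measurable_fun setT (fun x : measurableTypeR R => (g x)%:E) by exact/measurable_EFinP.
rewrite -[in LHS](preimage_setT U).
rewrite -(integral_pushforward mU mg' ig measurableT); congr fine.
by apply: eq_measure_integral => A mA _; rewrite /= /pushforward; exact: Unu.
Qed.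

Section Law.
Variable U : Omega -> R.
Hypothesis gU : is_gaussian P U.
Hypothesis qU : sq_integrable P U.
Hypothesis U0 : \int[P]_w U w = 0.

(** The parameters in [is_gaussian] are anonymous; they are recovered as moments of the law. The
    Dirac case [s = 0] is integrated separately. *)
Lemma centered_gaussian_law : exists s, [/\ 0 <= s, s ^+ 2 = \int[P]_w U w ^+ 2 &
  forall A : set R, measurable A -> P (U @^-1` A) = gaussian_law 0 s A].
Proof.
have [m [s [s0 law]]] := gU.
have mU : measurable_fun setT U by case: qU.
have iU := sq_integrable_integrable qU.
move: law; rewrite /gaussian_law; have [s_eq0|s_neq0] := eqVneq s 0 => law.
  have E (g : R -> R) : measurable_fun setT g ->
      P.-integrable setT (fun w => (g (U w))%:E) -> \int[P]_w g (U w) = g m.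
    move=> mg ig; rewrite (integral_law mU (nu := @dirac _ (measurableTypeR R) m R) law mg ig).
    rewrite /Rintegral integral_dirac//; first by rewrite diracT mul1e.
    exact/measurable_EFinP.
  have m0 : m = 0 by rewrite -U0 (E id).
  exists 0; split=> //; last by move=> A mA; rewrite eqxx -m0; exact: law.
  by rewrite (E (fun x => x ^+ 2)) ?m0 ?expr0n//; case: qU.
have {}s0 : 0 < s by rewrite lt_neqAle eq_sym s_neq0.
have m0 : m = 0.
  have [_ <-] := normal_prob_mean m s0.
  by rewrite -U0 (integral_law mU (nu := normal_prob m s) law (g := id)).
exists s; split; [exact: ltW| |by move=> A mA; rewrite (negbTE s_neq0) -m0; exact: law].
have [_ <-] := normal_prob_sqr 0 s0.
rewrite (integral_law mU (nu := normal_prob m s) law (g := fun x => x ^+ 2)).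
- by rewrite m0; apply: eq_Rintegral => x _; rewrite subr0.
- exact: measurable_funX.
- by case: qU.
Qed.

Lemma centered_gaussian_cos t :
  \int[P]_w cos (U w + t) = cos t * expR (- (\int[P]_w U w ^+ 2) / 2).
Proof.
have [s [s0 <- law]] := centered_gaussian_law.
have mU : measurable_fun setT U by case: qU.
have mc : measurable_fun setT (fun x : R => cos (x + t)).
  apply: measurableT_comp; last exact: measurable_funD.
  exact: (continuous_measurable_fun (@continuous_cos R)).
have ic : P.-integrable setT (fun w => (cos (U w + t))%:E).
  apply: (@bounded_integrable _ _ _ P (fun w => cos (U w + t)) 1).
    exact: (measurableT_comp mc).
  by move=> w; rewrite ler_norml cos_geN1 cos_le1.
move: law; rewrite /gaussian_law; have [s_eq0|s_neq0] := eqVneq s 0 => law.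
  rewrite (integral_law mU (nu := @dirac _ (measurableTypeR R) 0 R) law mc ic).
  rewrite /Rintegral integral_dirac//; last exact/measurable_EFinP.
  by rewrite diracT mul1e/= add0r s_eq0 expr0n/= oppr0 mul0r expR0 mulr1.
have {}s0 : 0 < s by rewrite lt_neqAle eq_sym s_neq0.
rewrite (integral_law mU (nu := normal_prob 0 s) law mc ic).
have := normal_prob_cos s0 1 t; rewrite mulr1 => <-.
by apply: eq_Rintegral => x _; rewrite mul1r.
Qed.

End Law.
End CenteredGaussian.

Lemma Rintegral_prod {d1 d2 : measure_display} {T1 : measurableType d1}
    {T2 : measurableType d2} {R : realType} (P1 : probability T1 R)
    (P2 : probability T2 R) (h : T1 * T2 -> R) (M : R) :
  measurable_fun setT h -> (forall z, `|h z| <= M) ->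
  \int[(P1 \x P2)%E]_z h z = \int[P1]_x (\int[P2]_y h (x, y)).
Proof.
move=> mh hM.
have ih : (P1 \x P2)%E.-integrable setT (EFin \o h).
  exact: (bounded_integrable (P1 \x P2)%E mh hM).
have mhx x : measurable_fun setT (fun y => h (x, y)) by exact: measurableT_comp.
rewrite /Rintegral -(integral12_prod_meas1 ih) /fubini_F; congr fine.
apply: eq_integral => x _ /=; rewrite fineK//.
apply: integrable_fin_num => //.
by apply: (@bounded_integrable _ _ _ P2 (fun y => h (x, y)) M).
Qed.

Section GaussianProcess.
Context {d : measure_display} {Omega : measurableType d} {R : realType}.
Variables (P : probability Omega R) (X : R -> {RV P >-> R}) (r : R -> R).
Hypothesis X_gaussian : gaussian_process X.
Hypothesis X_centered : centered X.
Hypothesis X_cov :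
  forall s t : R, ('E_P[fun w => (X s w * X t w)%R] = (r (t - s))%:E)%E.
Hypothesis r0 : 0 < r 0.

Lemma measurable_process t : measurable_fun setT (X t : Omega -> R).
Proof. exact: measurable_funP. Qed.

Lemma sq_integrable_process t : sq_integrable P (X t).
Proof.
split; first exact: measurable_process.
have mX2 : measurable_fun setT (fun w => (X t w : R) ^+ 2).
  by apply: measurable_funX; exact: measurable_process.
apply/integrableP; split; first exact/measurable_EFinP.
(* Square integrability is read off from the covariance at [(t, t)] being a real number. *)
rewrite integral_fin_num_abs//.
have := X_cov t t; rewrite unlock => h.
by under eq_integral do rewrite expr2; rewrite h.
Qed.

Lemma Rintegral_process t : \int[P]_w X t w = 0.
Proof. by have := X_centered t; rewrite unlock /Rintegral => ->. Qed.

Lemma Rintegral_processM s t : \int[P]_w (X s w * X t w) = r (t - s).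
Proof. by have := X_cov s t; rewrite unlock /Rintegral => ->. Qed.

Lemma Rintegral_process_sqr t : \int[P]_w (X t w ^+ 2) = r 0.
Proof.
rewrite -(subrr t) -Rintegral_processM.
by apply: eq_Rintegral => w _; rewrite expr2.
Qed.

Section Combination.
Variables (n : nat) (t c : 'I_n -> R).
Let S w := \sum_i c i * X (t i) w.

Lemma sq_integrable_comb : sq_integrable P S.
Proof.
apply: sq_integrable_sum => i; apply: sq_integrableZ.
exact: sq_integrable_process.
Qed.

Lemma Rintegral_comb : \int[P]_w S w = 0.
Proof.
rewrite Rintegral_sum; last first.
  move=> i; apply: sq_integrable_integrable.
  by apply: sq_integrableZ; exact: sq_integrable_process.
rewrite big1// => i _; rewrite RintegralZl//.
  by rewrite Rintegral_process mulr0.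
by apply: sq_integrable_integrable; exact: sq_integrable_process.
Qed.

Lemma Rintegral_processM_comb s :
  \int[P]_w (X s w * S w) = \sum_i c i * r (t i - s).
Proof.
under eq_Rintegral do rewrite mulr_sumr.
rewrite Rintegral_sum; last first.
  move=> i; apply: sq_integrableM; first exact: sq_integrable_process.
  by apply: sq_integrableZ; exact: sq_integrable_process.
apply: eq_bigr => i _; rewrite -Rintegral_processM -RintegralZl//; last first.
  by apply: sq_integrableM; exact: sq_integrable_process.
by apply: eq_Rintegral => w _; ring.
Qed.

(* The residual of the regression of [S] on [X s]. *)
Lemma residual_gaussian s a : is_gaussian P (fun w => S w - a * X s w).
Proof.
have [m [v h]] := X_gaussian
  (fun i : 'I_n.+1 => oapp t s (unlift ord0 i))
  (fun i : 'I_n.+1 => oapp c (- a) (unlift ord0 i)).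
exists m, v; rewrite (_ : (fun w => _) = (fun w => \sum_(i < n.+1)
    oapp c (- a) (unlift ord0 i) * X (oapp t s (unlift ord0 i)) w))//.
apply/funext => w; rewrite big_ord_recl unlift_none/= mulNr addrC; congr (_ + _).
by apply: eq_bigr => i _; rewrite liftK.
Qed.

Lemma sq_integrable_residual s a :
  sq_integrable P (fun w => S w - a * X s w).
Proof.
rewrite (_ : (fun w => _) = fun w => S w + - a * X s w); last first.
  by apply/funext => w; rewrite mulNr.
apply: sq_integrableD; first exact: sq_integrable_comb.
by apply: sq_integrableZ; exact: sq_integrable_process.
Qed.

Lemma Rintegral_residual s a : \int[P]_w (S w - a * X s w) = 0.
Proof.
have i1 := sq_integrable_integrable sq_integrable_comb.
have i2 := sq_integrable_integrable (sq_integrableZ a (sq_integrable_process s)).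
rewrite RintegralB// Rintegral_comb RintegralZl// ?Rintegral_process ?mulr0 ?subrr//.
by apply: sq_integrable_integrable; exact: sq_integrable_process.
Qed.

(** This [a] makes the residual orthogonal to [X s], whence a Pythagorean identity. *)
Lemma Rintegral_residual_sqr s a : a = (\sum_i c i * r (t i - s)) / r 0 ->
  \int[P]_w (S w - a * X s w) ^+ 2 = \int[P]_w (S w ^+ 2) - a ^+ 2 * r 0.
Proof.
move=> aE.
have qX := sq_integrable_process s; have qS := sq_integrable_comb.
have iX := integrableZl measurableT (a ^+ 2) qX.2.
have iXS := integrableZl measurableT (2 * a) (sq_integrableM qX qS).
have E : \int[P]_w (S w - a * X s w) ^+ 2 =
    \int[P]_w (S w ^+ 2 - 2 * a * (X s w * S w) + a ^+ 2 * X s w ^+ 2).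
  by apply: eq_Rintegral => w _; ring.
rewrite E RintegralD//; last first.
  by have := integrableB measurableT qS.2 iXS; apply: eq_integrable.
rewrite RintegralB//; last exact: qS.2.
rewrite !RintegralZl//; [|exact: qX.2|exact: sq_integrableM].
rewrite Rintegral_processM_comb Rintegral_process_sqr.
have -> : \sum_i c i * r (t i - s) = a * r 0 by rewrite aE divfK ?gt_eqF.
ring.
Qed.

End Combination.

Local Notation sigma := (Num.sqrt (r 0)).

(* [X] has the law of the process obtained by replacing, in its regression on
   [X s], the variable [X s] by an independent copy. *)
Lemma regression_box n (t e x : 'I_n -> R) (s : R) :
  P [set w | forall i, e i * X (t i) w < x i] =
  (P \x normal_prob 0 sigma)%E [set wz | forall i,
    e i * (r (t i - s) / r 0 * wz.2 + (X (t i) wz.1 - r (t i - s) / r 0 * X s wz.1))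
    < x i].
Proof.
have s0 : 0 < sigma by rewrite sqrtr_gt0.
pose N := normal_prob 0 sigma.
pose c i := r (t i - s) / r 0.
pose V i (wz : Omega * measurableTypeR R) :=
  e i * (c i * wz.2 + (X (t i) wz.1 - c i * X s wz.1)).
have mfst (g : Omega -> R) : measurable_fun setT g ->
    measurable_fun setT (fun wz : Omega * measurableTypeR R => g wz.1).
  by move=> mg; exact: measurableT_comp.
have mV i : measurable_fun setT (V i).
  apply: measurable_funM => //; apply: measurable_funD.
    exact: measurable_funM.
  apply: measurable_funB; first by apply: mfst; exact: measurable_process.
  apply: measurable_funM => //; apply: mfst; exact: measurable_process.
apply: (@eq_cosine_transform_box _ _ _ _ _ P (P \x N)%E n
  (fun i w => e i * X (t i) w) V) => //.
  by move=> i; apply: measurable_funM => //; exact: measurable_process.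
move=> u th.
pose b i := u i * e i.
pose S w := \sum_i b i * X (t i) w.
pose a := (\sum_i b i * r (t i - s)) / r 0.
have -> : \int[P]_w cos (\sum_i u i * (e i * X (t i) w) + th) =
    \int[P]_w cos (S w + th).
  apply: eq_Rintegral => w _; congr (cos (_ + _)).
  by apply: eq_bigr => i _; rewrite /b mulrA.
(* A combination of the [V i] is again a multiple of [z] plus a residual, where [a] is the
   regression coefficient of the whole combination [S]. *)
have VE wz : \sum_i u i * V i wz = a * wz.2 + (S wz.1 - a * X s wz.1).
  rewrite /a /S /V /c !mulr_suml -sumrB -big_split/=.
  by apply: eq_bigr => i _; rewrite /b; ring.
rewrite (@Rintegral_prod _ _ _ _ _ P N
  (fun wz => cos (\sum_i u i * V i wz + th)) 1); last 2 first.
- apply: measurableT_comp; first exact: (continuous_measurable_fun (@continuous_cos R)).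
  apply: measurable_funD => //.
  by apply: measurable_sum => i; exact: measurable_funM.
- by move=> z; rewrite ler_norml cos_geN1 cos_le1.
have inner w : \int[N]_z cos (\sum_i u i * V i (w, z) + th) =
    cos (S w - a * X s w + th) * expR (- (sigma * a) ^+ 2 / 2).
  rewrite -normal_prob_cos//; apply: eq_Rintegral => z _.
  by rewrite VE/= -addrA.
under [RHS]eq_Rintegral do rewrite inner.
have gS : is_gaussian P S by exact: X_gaussian.
rewrite (centered_gaussian_cos gS (sq_integrable_comb t b) (Rintegral_comb t b)).
have qY := sq_integrable_residual t b s a.
rewrite RintegralZr//; last first.
  apply: (@bounded_integrable _ _ _ P (fun w => cos (S w - a * X s w + th)) 1).
    apply: measurableT_comp; first exact: (continuous_measurable_fun (@continuous_cos R)).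
    by apply: measurable_funD => //; case: qY.
  by move=> w; rewrite ler_norml cos_geN1 cos_le1.
rewrite (centered_gaussian_cos (residual_gaussian t b s a) qY
  (Rintegral_residual t b s a)).
(* The independent term restores in the exponent exactly the variance [a ^ 2 * r 0] that the
   residual has lost. *)
rewrite (@Rintegral_residual_sqr _ t b s a)// -mulrA -expRD; congr (_ * expR _).
by rewrite (exprMn _ sigma a) sqr_sqrtr ?ltW//; field.
Qed.

End GaussianProcess.

(** * Sign changes over a short step *)

Section NormalIntervals.
Context {R : realType}.
Variable s : R.
Hypothesis s0 : 0 < s.
Let sn0 : s != 0. Proof. by rewrite gt_eqF. Qed.

Lemma normal_prob_set1 (x : R) : normal_prob 0 s [set x] = 0%E.
Proof. by rewrite /normal_prob integral_set1. Qed.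

Lemma normal_prob_itv_le (a b : R) : a <= b ->
  (normal_prob 0 s `[a, b] <= (normal_peak s * (b - a))%:E)%E.
Proof.
move=> ab; rewrite /normal_prob.
apply: (@le_trans _ _ (\int[lebesgue_measure]_(x in `[a, b]) (normal_peak s)%:E)%E).
  apply: ge0_le_integral => //.
  - by move=> x _; rewrite lee_fin normal_pdf_ge0.
  - by apply/measurable_EFinP/measurable_funTS; exact: measurable_normal_pdf.
  - by move=> x _; rewrite lee_fin normal_pdf_ub.
rewrite integral_cst//= lebesgue_measure_itv/= lte_fin.
case: ltP => ba; first by rewrite EFinM EFinB.
by rewrite mule0 lee_fin mulr_ge0 ?normal_peak_ge0// subr_ge0.
Qed.

(** A lower bound affine in [|x|] is enough: integrated over an interval of length proportional to
    the residual, its error is a multiple of the square of the residual. *)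
Lemma normal_pdf_ge (x : R) : normal_peak s * (1 - `|x| / s) <= normal_pdf 0 s x.
Proof.
rewrite normal_pdfE// /normal_fun subr0 ler_wpM2l ?normal_peak_ge0//.
set y := `|x| / s.
have y0 : 0 <= y by rewrite divr_ge0// ltW.
have -> : - x ^+ 2 / (s ^+ 2 *+ 2) = - (y ^+ 2 / 2).
  by rewrite /y exprMn real_normK ?num_real//; field.
have [y1|y1] := leP y 1; last first.
  by apply: le_trans (expR_ge0 _); lra.
apply: le_trans (expR_ge1Dx _); nra.
Qed.

Lemma normal_prob_itv_ge (a b M : R) : a <= b ->
  (forall x, a < x < b -> `|x| <= M) ->
  ((normal_peak s * (1 - M / s) * (b - a))%:E <= normal_prob 0 s `]a, b[)%E.
Proof.
move=> ab xM.
(* A negative factor makes the bound trivial; otherwise the constant function is nonnegative and can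
   be compared with the density. *)
have [c0|c0] := ltP (1 - M / s) 0.
  apply: (@le_trans _ _ 0%E); last exact: measure_ge0.
  rewrite lee_fin nmulr_rle0 ?subr_ge0// nmulr_llt0//.
  by rewrite normal_peak_gt0.
rewrite /normal_prob.
apply: (@le_trans _ _ (\int[lebesgue_measure]_(x in `]a, b[)
    (normal_peak s * (1 - M / s))%:E)%E); last first.
  apply: ge0_le_integral => //.
  - by move=> x _; rewrite lee_fin mulr_ge0 ?normal_peak_ge0.
  - by apply/measurable_EFinP/measurable_funTS; exact: measurable_normal_pdf.
  - move=> x /=; rewrite in_itv/= => /xM xM'; rewrite lee_fin.
    apply: le_trans (normal_pdf_ge x); rewrite ler_wpM2l ?normal_peak_ge0//.
    by rewrite lerB// ler_pM2r// invr_gt0.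
rewrite integral_cst//= lebesgue_measure_itv/= lte_fin.
case: ltP => ba; first by rewrite -EFinB -EFinM.
by rewrite mule0 lee_fin mulr_ge0_le0 ?mulr_ge0 ?normal_peak_ge0// subr_le0.
Qed.

(* The set of [z] such that [z] and [c z + y] have opposite signs is the open
   interval between [0] and [- y / c]. *)
Lemma normal_prob_sign_change (c y : R) : 0 < c ->
  ((normal_peak s * (`|y| / c) * (1 - `|y| / c / s))%:E <=
    normal_prob 0 s [set z | z * (c * z + y) < 0]%R)%E /\
  (normal_prob 0 s [set z | z * (c * z + y) < 0]%R <=
    (normal_peak s * (`|y| / c))%:E)%E.
Proof.
move=> c0.
suff [a [b [ab -> len xM]]] : exists a b : R, [/\ a <= b,
    [set z | z * (c * z + y) < 0]%R = `]a, b[%classic, b - a = `|y| / c &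
    forall x, a < x < b -> `|x| <= `|y| / c].
  split; first by rewrite mulrAC -len; apply: normal_prob_itv_ge; rewrite // len.
  rewrite -len; apply: le_trans (normal_prob_itv_le ab).
  by apply: le_measure; rewrite ?inE//; exact: subset_itv_oo_cc.
have fac z : z * (c * z + y) = c * (z * (z + y / c)) by field; rewrite gt_eqF.
have sgn z : (z * (c * z + y) < 0) = (z * (z + y / c) < 0).
  by rewrite fac pmulr_rlt0.
have [y0|y0] := leP 0 y.
  exists (- (y / c)), 0; split.
  - by rewrite oppr_le0 divr_ge0// ltW.
  - apply/seteqP; split=> z /=; rewrite in_itv/= sgn.
      have yc : 0 <= y / c by rewrite divr_ge0// ltW.
      by move=> h; apply/andP; split; nra.
    by move=> /andP[h1 h2]; rewrite nmulr_rlt0//; lra.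
  - by rewrite sub0r opprK ger0_norm.
  - by move=> x /andP[h1 h2]; rewrite ltr0_norm// ger0_norm//; lra.
exists 0, (- (y / c)); have yc : y / c < 0 by rewrite pmulr_llt0// invr_gt0.
split.
- by rewrite oppr_ge0 ltW.
- apply/seteqP; split=> z /=; rewrite in_itv/= sgn.
    by move=> h; apply/andP; split; nra.
  by move=> /andP[h1 h2]; rewrite pmulr_rlt0//; lra.
- by rewrite subr0 ltr0_norm// mulNr.
- by move=> x /andP[h1 h2]; rewrite gtr0_norm// ltr0_norm// mulNr; lra.
Qed.

End NormalIntervals.

Section GaussianProcess.
Context {d : measure_display} {Omega : measurableType d} {R : realType}.
Variables (P : probability Omega R) (X : R -> {RV P >-> R}) (r : R -> R).
Hypothesis X_gaussian : gaussian_process X.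
Hypothesis X_centered : centered X.
Hypothesis X_cov :
  forall s t : R, ('E_P[fun w => (X s w * X t w)%R] = (r (t - s))%:E)%E.
Hypothesis r0 : 0 < r 0.
Local Notation sigma := (Num.sqrt (r 0)).
Let sigma0 : 0 < sigma. Proof. by rewrite sqrtr_gt0. Qed.

Lemma process_neq0 t : P [set w | X t w = 0] = 0%E.
Proof.
have E : (fun w => \sum_(i < 1) 1 * X t w) = X t :> (Omega -> R).
  by apply/funext => w; rewrite big_ord1 mul1r.
have gX : is_gaussian P (X t).
  by have := X_gaussian (fun _ : 'I_1 => t) (fun=> 1); rewrite E.
have [v [v0 vE law]] := centered_gaussian_law gX
  (sq_integrable_process X_cov t) (Rintegral_process X_centered t).
have {}v0 : 0 < v.
  rewrite lt_neqAle v0 andbT eq_sym; apply/eqP => v_eq0.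
  move: vE; rewrite v_eq0 expr0n/= (Rintegral_process_sqr X_cov) => /eqP.
  by rewrite lt_eqF.
have := law [set 0] (measurable_set1 0).
by rewrite /gaussian_law gt_eqF// normal_prob_set1.
Qed.

Let mulr_lt0P (x y : R) : x * y < 0 <-> (x < 0 /\ 0 < y) \/ (0 < x /\ y < 0).
Proof.
split=> [|[[x0 y0]|[x0 y0]]]; [|by rewrite nmulr_rlt0|by rewrite pmulr_rlt0].
have [x0|x0|->] := ltgtP x 0; last by rewrite mul0r ltxx.
- by rewrite nmulr_rlt0//; left.
- by rewrite pmulr_rlt0//; right.
Qed.

Section SignChange.
Variables (s h : R).
Hypothesis rh0 : 0 < r h.
Hypothesis rh1 : r h < r 0.
Let c := r h / r 0.
Let tau := Num.sqrt ((r 0 - r h) * (r 0 + r h) / r 0).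

(** Here [tau ^ 2 = r 0 - c ^ 2 * r 0] is the variance of the residual [Y]. Conditionally on [Y] the
    sign change confines [z] to an interval of length [|Y| / c] ending at 0; the expectation of that
    length gives the main term, and the variation of the density over it gives an error in
    [tau ^ 2]. *)
Lemma sign_change_prob_bounds :
  ((tau / (pi * sigma * c) - normal_peak sigma * tau ^+ 2 / (c ^+ 2 * sigma))%:E
     <= P [set w | X s w * X (s + h) w < 0]%R)%E /\
  (P [set w | X s w * X (s + h) w < 0]%R <= (tau / (pi * sigma * c))%:E)%E.
Proof.
have c0 : 0 < c by rewrite divr_gt0.
have tau0 : 0 < tau.
  by rewrite sqrtr_gt0 divr_gt0// mulr_gt0 ?subr_gt0// addr_gt0.
pose Y w : R := X (s + h) w - c * X s w.
have mY : measurable_fun setT Y by apply: measurable_funB => //; exact: measurable_funM.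
have YE : Y = (fun w => \sum_(i < 1) 1 * X (s + h) w - c * X s w).
  by apply/funext => w; rewrite big_ord1 mul1r.
have gY : is_gaussian P Y by rewrite YE; exact: residual_gaussian.
have qY : sq_integrable P Y by rewrite YE; exact: sq_integrable_residual.
have EY : \int[P]_w Y w = 0.
  by rewrite YE; exact: (Rintegral_residual X_centered X_cov).
have EY2 : \int[P]_w Y w ^+ 2 = tau ^+ 2.
  rewrite YE (Rintegral_residual_sqr X_cov r0); last first.
    by rewrite big_ord1 mul1r addrAC subrr add0r.
  under eq_Rintegral do rewrite big_ord1 mul1r.
  rewrite (Rintegral_process_sqr X_cov) sqr_sqrtr; last first.
    by rewrite divr_ge0 ?mulr_ge0 ?subr_ge0 ?addr_ge0 ?ltW.
  by rewrite /c; field; rewrite gt_eqF.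
have [v [v0 vE law]] := centered_gaussian_law gY qY EY.
have {}v0 : v = tau.
  by apply/eqP; rewrite -(@eqrXn2 _ 2)// ?vE ?EY2// ltW.
have EYabs : \int[P]_w `|Y w| = 2 * tau ^+ 2 * normal_peak tau.
  have [_ <-] := normal_prob_abs tau0.
  apply: (integral_law (nu := normal_prob 0 tau) (g := fun x : R => `|x|)) => //.
  - by move=> A mA; rewrite law// /gaussian_law v0 gt_eqF.
  - exact: measurableT_comp.
  - by have := integrable_abse (sq_integrable_integrable qY).
have iabs : P.-integrable setT (fun w => `|Y w|%:E).
  by have := integrable_abse (sq_integrable_integrable qY).
pose A : set (Omega * measurableTypeR R) := [set wz | wz.2 * (c * wz.2 + Y wz.1) < 0].
have mA : measurable A.
  have mf : measurable_fun setT (fun wz : Omega * measurableTypeR R =>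
      (wz.2 : R) * (c * wz.2 + Y wz.1)).
    apply: measurable_funM => //; apply: measurable_funD.
      exact: measurable_funM.
    exact: measurableT_comp.
  rewrite (_ : A = setT `&` (fun wz : Omega * measurableTypeR R =>
      (wz.2 : R) * (c * wz.2 + Y wz.1)) @^-1` `]-oo, 0[%classic).
    exact: mf.
  by rewrite setTI; apply/seteqP; split=> wz; rewrite /= in_itv.
have secE w : [set z | z * (c * z + Y w) < 0]%R = xsection A w.
  by apply/seteqP; split=> z; rewrite /xsection /= inE.
have PE : P [set w | X s w * X (s + h) w < 0]%R =
    (\int[P]_w normal_prob 0 sigma [set z | z * (c * z + Y w) < 0]%R)%E.
  pose t (i : 'I_2) := if i == ord0 then s else s + h.
  (* A sign change is the disjoint union of the two boxes with weights [(x, - x)], for [x = 1] and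
     [x = -1]; negative weights are what lets a box carry a lower bound. *)
  pose e (x : R) (i : 'I_2) := if i == ord0 then x else - x.
  have all2 (Q : bool -> Prop) : (forall i : 'I_2, Q (i == ord0)) <-> Q true /\ Q false.
    split=> [h'|[Q1 Q0] i]; last by case: eqP.
    by split; [exact: (h' ord0)|exact: (h' (lift ord0 ord0))].
  pose B x := [set w | forall i : 'I_2, e x i * X (t i) w < 0].
  pose B' x := [set wz : Omega * measurableTypeR R | forall i : 'I_2,
    e x i * (r (t i - s) / r 0 * wz.2 + (X (t i) wz.1 - r (t i - s) / r 0 * X s wz.1))
    < 0].
  have BB' x : P (B x) = (P \x normal_prob 0 sigma)%E (B' x).
    exact: (regression_box X_gaussian X_centered X_cov r0 t (e x) (fun=> 0) s).
  have BE x w : B x w <-> x * X s w < 0 /\ - x * X (s + h) w < 0.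
    exact: (all2 (fun b => (if b then x else - x) * X (if b then s else s + h) w < 0)).
  have B'E x wz : B' x wz <-> x * wz.2 < 0 /\ - x * (c * wz.2 + Y wz.1) < 0.
    have := all2 (fun b => (if b then x else - x) *
      (r ((if b then s else s + h) - s) / r 0 * wz.2 +
       (X (if b then s else s + h) wz.1 - r ((if b then s else s + h) - s) / r 0 * X s wz.1)) < 0).
    rewrite subrr divff ?gt_eqF// !mul1r subrr addr0.
    by rewrite [s + h - s]addrAC subrr add0r.
  have -> : [set w | X s w * X (s + h) w < 0] = B 1 `|` B (- 1).
    apply/seteqP; split=> w /=; rewrite !BE !mulN1r !mul1r opprK mul1r.
      by move=> /mulr_lt0P[[]|[]] ? ?; [left|right]; split; lra.
    by move=> h'; apply/mulr_lt0P; case: h' => -[? ?]; [left|right]; split; lra.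
  have mB x : measurable (B x).
    apply: (measurable_box (fun=> 0)) => i; exact: measurable_funM.
  have mB' x : measurable (B' x).
    apply: (measurable_box (fun=> 0)) => i.
    have mfst (g : Omega -> R) : measurable_fun setT g ->
      measurable_fun setT (fun wz : Omega * measurableTypeR R => g wz.1).
      by move=> mg; exact: measurableT_comp.
    apply: measurable_funM => //; apply: measurable_funD.
      by apply: measurable_funM => //; exact: measurable_snd.
    apply: (mfst (fun w => X (t i) w - r (t i - s) / r 0 * X s w)).
    by apply: measurable_funB => //; exact: measurable_funM.
  have AE : A = B' 1 `|` B' (- 1).
    apply/seteqP; split=> wz /=; rewrite !B'E !mulN1r !mul1r opprK mul1r.
      by move=> /mulr_lt0P[[]|[]] ? ?; [left|right]; split; lra.
    by move=> h'; apply/mulr_lt0P; case: h' => -[? ?]; [left|right]; split; lra.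
  rewrite measureU//; last first.
    by apply/seteqP; split=> // w [] /BE[+ _] /BE[+ _]; rewrite mulN1r mul1r; lra.
  transitivity ((P \x normal_prob 0 sigma) (B' 1%R) + (P \x normal_prob 0 sigma) (B' (- 1)%R))%E.
    by congr (_ + _)%E; exact: BB'.
  rewrite -(measureU (P \x normal_prob 0 sigma)%E)//; last first.
    by apply/seteqP; split=> // wz [] /B'E[+ _] /B'E[+ _]; rewrite mulN1r mul1r; lra.
  rewrite -AE /product_measure1 /=; apply: eq_integral => w _ /=.
  by rewrite secE.
have EFin_int (g : Omega -> R) : P.-integrable setT (EFin \o g) ->
    (\int[P]_w (g w)%:E = (\int[P]_w g w)%:E)%E.
  by move=> ig; rewrite /Rintegral fineK//; exact: integrable_fin_num.
have mN : measurable_fun setT (fun w => normal_prob 0 sigma [set z | z * (c * z + Y w) < 0]%R).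
  rewrite (_ : (fun w => _) = normal_prob 0 sigma \o xsection A).
    exact: measurable_fun_xsection.
  by apply/funext => w /=; rewrite secE.
have iN : P.-integrable setT (fun w => normal_prob 0 sigma [set z | z * (c * z + Y w) < 0]%R).
  have i1 : P.-integrable setT (EFin \o cst (1 : R)).
    exact: finite_measure_integrable_cst.
  apply: (le_integrable measurableT mN _ i1) => w _.
  rewrite gee0_abs// /= normr1 secE; apply: probability_le1.
  exact: measurable_xsection.
(* Each peak contributes a factor [1 / sqrt (2 pi)]; together they produce the [pi] of the final
   formula. *)
have peaks : normal_peak sigma * (2 * tau ^+ 2 * normal_peak tau) = tau / (pi * sigma).
  have peakE (v' : R) : 0 < v' -> normal_peak v' = (v' * Num.sqrt (pi *+ 2))^-1.
    move=> v'0; rewrite /normal_peak -mulrnAr sqrtrM ?sqr_ge0//.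
    by rewrite sqrtr_sqr gtr0_norm.
  have pi0 := @pi_gt0 R.
  rewrite !peakE//; set q := Num.sqrt (pi *+ 2).
  have q0 : 0 < q by rewrite sqrtr_gt0 mulrn_wgt0.
  have -> : pi = q ^+ 2 / 2.
    rewrite sqr_sqrtr; last by rewrite mulrn_wge0 // ltW.
    by rewrite -(mulr_natr pi); field.
  by field; rewrite !gt_eqF.
have iup : P.-integrable setT (fun w => (normal_peak sigma * (`|Y w| / c))%:E).
  have := integrableZl measurableT (normal_peak sigma / c) iabs.
  by apply: eq_integrable => // w _ /=; rewrite -EFinM; congr EFin; ring.
have upE : \int[P]_w (normal_peak sigma * (`|Y w| / c)) = tau / (pi * sigma * c).
  have -> : \int[P]_w (normal_peak sigma * (`|Y w| / c)) =
      \int[P]_w (normal_peak sigma / c * `|Y w|).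
    by apply: eq_Rintegral => w _; ring.
  rewrite RintegralZl// EYabs mulrAC peaks.
  by move: (@pi_gt0 R); generalize (@pi R) => p p0; field; rewrite !gt_eqF.
have ilow : P.-integrable setT
    (fun w => (normal_peak sigma / (c ^+ 2 * sigma) * Y w ^+ 2)%:E).
  by have := integrableZl measurableT (normal_peak sigma / (c ^+ 2 * sigma)) qY.2;
     apply: eq_integrable.
have lowE w : normal_peak sigma * (`|Y w| / c) * (1 - `|Y w| / c / sigma) =
   normal_peak sigma * (`|Y w| / c) - normal_peak sigma / (c ^+ 2 * sigma) * Y w ^+ 2.
  rewrite -[Y w ^+ 2]real_normK ?num_real//; field.
  by rewrite !gt_eqF.
rewrite PE; split.
- rewrite -upE mulrAC -EY2 -RintegralZl//; last exact: qY.2.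
  rewrite -RintegralB// -EFin_int; last first.
    by have := integrableB measurableT iup ilow; apply: eq_integrable.
  apply: le_integral => //.
    by have := integrableB measurableT iup ilow; apply: eq_integrable.
  move=> w _; rewrite -lowE.
  exact: (normal_prob_sign_change sigma0 (Y w) c0).1.
- rewrite -upE -EFin_int//.
  apply: le_integral => // w _.
  exact: (normal_prob_sign_change sigma0 (Y w) c0).2.
Qed.

End SignChange.

End GaussianProcess.

(** * Tangential zeros *)

Section Mesh.
Context {R : realType}.

(** For [n = 0] the division returns 0 and every point is [p]; for [i > n] the points continue
    beyond [q] when [p < q]. *)
Definition mesh (p q : R) (n i : nat) : R := p + (q - p) * i%:R / n%:R.

Lemma mesh0 p q n : mesh p q n 0 = p.
Proof. by rewrite /mesh mulr0 mul0r addr0. Qed.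

Lemma mesh_last p q n : (0 < n)%N -> mesh p q n n = q.
Proof.
move=> n0; have n0' : n%:R != 0 :> R by rewrite pnatr_eq0 -lt0n.
by rewrite /mesh mulfK// addrC subrK.
Qed.

Lemma meshS p q n i : mesh p q n i.+1 = mesh p q n i + (q - p) / n%:R.
Proof. by rewrite /mesh -natr1 mulrDr mulr1 mulrDl addrA. Qed.

Lemma mesh_le p q n i j : p <= q -> (i <= j)%N -> mesh p q n i <= mesh p q n j.
Proof.
move=> pq ij; rewrite /mesh lerD2l ler_wpM2r ?invr_ge0// ler_wpM2l ?subr_ge0//.
by rewrite ler_nat.
Qed.

Lemma mesh_itv p q n i : p <= q -> (i <= n)%N -> p <= mesh p q n i <= q.
Proof.
case: n => [|n] pq i_n; first by move: i_n; rewrite leqn0 => /eqP ->; rewrite mesh0 lexx.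
by rewrite -{1}(mesh0 p q n.+1) mesh_le//= -{2}(@mesh_last p q n.+1)// mesh_le.
Qed.

Lemma mesh_bracket p q n t : (0 < n)%N -> p <= t <= q ->
  exists2 i, (i < n)%N & mesh p q n i <= t <= mesh p q n i.+1.
Proof.
move=> n0 /andP[pt tq].
have pq := le_trans pt tq.
have ex : exists k, t <= mesh p q n k by exists n; rewrite mesh_last.
case: (ex_minnP ex) => -[|k] tk kmin.
  exists 0%N => //; rewrite mesh0 pt/= (le_trans tk)// mesh_le//.
exists k; last by rewrite tk andbT leNgt; apply/negP => /ltW /kmin; rewrite ltnn.
by apply: kmin; rewrite mesh_last.
Qed.

End Mesh.

Section GaussianProcess.
Context {d : measure_display} {Omega : measurableType d} {R : realType}.
Variables (P : probability Omega R) (X : R -> {RV P >-> R}) (r : R -> R).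
Hypothesis X_gaussian : gaussian_process X.
Hypothesis X_centered : centered X.
Hypothesis X_paths : continuous_paths X.
Hypothesis X_cov :
  forall s t : R, ('E_P[fun w => (X s w * X t w)%R] = (r (t - s))%:E)%E.
Hypothesis r0 : 0 < r 0.
Local Notation sigma := (Num.sqrt (r 0)).
Let sigma0 : 0 < sigma. Proof. by rewrite sqrtr_gt0. Qed.

(* For a frozen residual the event confines [X s] to an interval of length
   [4 eps / c0]. *)
Lemma near_maximum_prob n (t : 'I_n -> R) (s e c0 eps : R) :
  `|e| = 1 -> 0 < c0 -> 0 <= eps -> (forall i, c0 <= r (t i - s) / r 0) ->
  (P ([set w | forall i, e * X (t i) w < eps]%R `\`
      [set w | forall i, e * X (t i) w < - eps]%R) <=
   (normal_peak sigma * (4 * eps / c0))%:E)%E.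
Proof.
move=> e1 c00 eps0 tc.
set N := normal_prob 0 sigma.
pose c i := r (t i - s) / r 0.
pose B x := [set w | forall i, e * X (t i) w < x].
pose B' x := [set wz : Omega * measurableTypeR R | forall i,
  e * (c i * wz.2 + (X (t i) wz.1 - c i * X s wz.1)) < x].
have BB' x : P (B x) = (P \x N)%E (B' x).
  exact: (regression_box X_gaussian X_centered X_cov r0 t (fun=> e) (fun=> x) s).
have mB x : measurable (B x).
  by apply: (measurable_box (fun=> x)) => i; exact: measurable_funM.
have mB' x : measurable (B' x).
  apply: (measurable_box (fun=> x)) => i.
  have mfst (g : Omega -> R) : measurable_fun setT g ->
    measurable_fun setT (fun wz : Omega * measurableTypeR R => g wz.1).
    by move=> mg; exact: measurableT_comp.
  apply: measurable_funM => //; apply: measurable_funD.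
    by apply: measurable_funM => //; exact: measurable_snd.
  apply: (mfst (fun w => X (t i) w - c i * X s w)).
  by apply: measurable_funB => //; exact: measurable_funM.
have sub : B (- eps) `<=` B eps.
  by move=> w h i; apply: lt_le_trans (h i) _; rewrite (@le_trans _ _ 0)// oppr_le0.
have sub' : B' (- eps) `<=` B' eps.
  by move=> w h i; apply: lt_le_trans (h i) _; rewrite (@le_trans _ _ 0)// oppr_le0.
have -> : P (B eps `\` B (- eps)) = (P \x N)%E (B' eps `\` B' (- eps)).
  rewrite measureD//; last exact: le_lt_trans (probability_le1 P (mB eps)) (ltry _).
  rewrite (@measureD _ _ _ (P \x N)%E)//; last first.
    exact: le_lt_trans (probability_le1 (P \x N)%E (mB' eps)) (ltry _).
  rewrite !setIidr//; congr (_ - _)%E; exact: BB'.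
set D := B' eps `\` B' (- eps).
have mD : measurable D by exact: measurableD.
apply: (@le_trans _ _ (\int[P]_w (normal_peak sigma * (4 * eps / c0))%:E)%E); last first.
  by rewrite integral_cst//= probability_setT mule1.
apply: ge0_le_integral => //.
  exact: measurable_fun_xsection.
move=> w _ /=.
have [->|/set0P[z0 Dz0]] := eqVneq (xsection D w) set0.
  by rewrite /N measure0 lee_fin mulr_ge0 ?normal_peak_ge0// divr_ge0 ?mulr_ge0// ltW.
set k := 2 * eps / c0.
have k0 : 0 <= k by rewrite divr_ge0 ?mulr_ge0// ltW.
(* At [z] some coordinate is at least [- eps], while at [z'] that same coordinate is below [eps];
   its slope in [e * z] is at least [c0]. *)
have key z z' : D (w, z) -> D (w, z') -> e * (z' - z) <= k.
  move=> [_ /existsNP[i /negP]] /=; rewrite -leNgt => lo [/(_ i) /= hi _].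
  rewrite leNgt; apply/negP => kz.
  have ci : c0 * k <= c i * (e * (z' - z)).
    by rewrite ler_pM ?(ltW c00) ?(ltW kz)//; exact: tc.
  have ck : c0 * k = 2 * eps by rewrite /k mulrC divfK// gt_eqF.
  lra.
have sub_itv : xsection D w `<=` `[z0 - k, z0 + k]%classic.
  move: Dz0; rewrite /xsection /= inE => Dz0 z /=; rewrite inE => Dz.
  rewrite in_itv/= -ler_distl -[leLHS]mul1r -e1 -normrM ler_norml.
  rewrite (key _ _ Dz0 Dz) andbT lerNl -mulrN opprB.
  exact: key.
apply: (@le_trans _ _ (N `[z0 - k, z0 + k]%classic)).
  by apply: le_measure => //; rewrite inE//; exact: measurable_xsection.
apply: le_trans (normal_prob_itv_le _ _) _ => //; first by lra.
by rewrite lee_fin ler_wpM2l ?normal_peak_ge0// /k; lra.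
Qed.

(** If 0 is the maximum of [e * X] on [[p, q]], the maximum over every fine enough mesh lies in [[-
    eps, eps[], by continuity at the zero. Regressing on [X p] bounds the probability of this by
    [K * eps], uniformly in the mesh, and [eps] tends to 0. *)
Lemma no_tangency (p q e c0 : R) : `|e| = 1 -> p < q -> 0 < c0 ->
  (forall u, 0 <= u <= q - p -> c0 <= r u / r 0) ->
  P.-negligible [set w | exists2 t, p <= t <= q &
    X t w = 0 /\ forall u, p <= u <= q -> e * X u w <= 0].
Proof.
move=> e1 pq c00 rc0.
have pq' := ltW pq.
pose t m (i : 'I_m.+2) := mesh p q m.+1 i.
have t_itv m i : p <= t m i <= q by rewrite /t mesh_itv// -ltnS.
pose B x m := [set w | forall i, e * X (t m i) w < x].
pose A eps m := B eps m `\` B (- eps) m.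
(* How fine the mesh must be depends on [w]. Asking for all meshes from [M] on makes the events
   increase with [M], so their union keeps the uniform bound. *)
pose F eps M := \bigcap_(m in [set m | (M <= m)%N]) A eps m.
pose L eps := \bigcup_M F eps M.
pose K := normal_peak sigma * (4 / c0).
have PA eps m : 0 <= eps -> (P (A eps m) <= (K * eps)%:E)%E.
  move=> eps0; have -> : K * eps = normal_peak sigma * (4 * eps / c0) by rewrite /K; ring.
  apply: (@near_maximum_prob _ (t m) p) => // i; apply: rc0.
  by have /andP[] := t_itv m i; lra.
have mA eps m : measurable (A eps m).
  apply: measurableD; apply: (measurable_box (fun=> _)) => i; exact: measurable_funM.
have mF eps M : measurable (F eps M) by apply: bigcap_measurableType => m _.
have mL eps : measurable (L eps) by apply: bigcup_measurable => M _.
have PL eps : 0 <= eps -> (P (L eps) <= (K * eps)%:E)%E.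
  move=> eps0.
  have nF : nondecreasing_seq (F eps).
    by move=> M M' MM'; apply/subsetPset => w h m /= M'm; apply: h => /=; exact: leq_trans M'm.
  have h := nondecreasing_cvg_mu (mu := P) (mF eps) (mL eps) nF.
  apply: (cvge_le _ h); apply: nearW => M; apply: le_trans (PA eps M eps0).
  by apply: le_measure; rewrite ?inE// => w; apply => /=.
pose Z := \bigcap_j L (j.+1%:R^-1).
have mZ : measurable Z by apply: bigcap_measurableType.
exists Z; split=> //.
  have PN j : (P Z <= (K * j.+1%:R^-1)%:E)%E.
    have PLj := PL (j.+1%:R^-1); apply: le_trans (PLj _) => //.
    by apply: le_measure; rewrite ?inE//; exact: bigcap_inf.
  rewrite -[LHS]fineK ?fin_num_measure//; congr EFin; apply/eqP.
  rewrite eq_le fine_ge0// andbT.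
  have lim0 : K * j.+1%:R^-1 @[j --> \oo] --> (0 : R).
    by rewrite -[X in _ --> X](mulr0 K); apply: cvgMl_tmp; exact: cvg_harmonic.
  apply: (cvgr_to_ge lim0); apply: nearW => j.
  by rewrite -lee_fin fineK ?fin_num_measure.
move=> w [t0 /andP[pt0 t0q] [Xt0 le0]] j _.
set eps := j.+1%:R^-1.
have eps0 : 0 < eps :> R by rewrite invr_gt0.
have cw : continuous (fun t => X t w : R) by exact: X_paths.
have /cvgrPdist_lt /(_ eps eps0) [dl /= dl0 near_t0] := cw t0.
have : \forall m \near \oo, (q - p) * m.+1%:R^-1 < dl.
  apply: (cvgr_lt (0 : R)) => //; rewrite -[X in _ --> X](mulr0 (q - p)).
  by apply: cvgMl_tmp; exact: cvg_harmonic.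
move=> [M _ hM]; exists M => // m /= Mm; split.
  by move=> i /=; apply: le_lt_trans (le0 _ (t_itv m i)) eps0.
have [i im /andP[ti tSi]] := @mesh_bracket _ p q m.+1 t0 isT (introT andP (conj pt0 t0q)).
have im' : (i < m.+2)%N by rewrite ltnS ltnW.
move=> /(_ (Ordinal im')) /=; rewrite /t /=; apply/negP; rewrite -leNgt.
have : `|t0 - mesh p q m.+1 i| < dl.
  rewrite ger0_norm ?subr_ge0//; apply: le_lt_trans (hM m Mm).
  by rewrite lerBlDl -meshS.
move=> /near_t0; rewrite Xt0 sub0r normrN => small.
have : `|e * X (mesh p q m.+1 i) w| < eps by rewrite normrM e1 mul1r.
by rewrite ltr_norml => /andP[/ltW].
Qed.

End GaussianProcess.

(** * Zeros and sign changes of a continuous function *)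

Section Counting.
Context {R : realType} {T : choiceType}.
Implicit Types A : set T.

Lemma counting_ge_inj (I : finType) (S : {set I}) (z : I -> T) A :
  {in S &, injective z} -> (forall i, i \in S -> A (z i)) ->
  ((#|S|%:R)%:E <= counting A :> \bar R)%E.
Proof.
move=> zinj zA; rewrite /counting; case: asboolP => [finA|]; last by rewrite leey.
rewrite lee_fin ler_nat cardE -(size_map z); apply: uniq_leq_size.
  rewrite map_inj_in_uniq ?enum_uniq// => i j.
  by rewrite !mem_enum; exact: zinj.
move=> y /mapP[i]; rewrite mem_enum => /zA Azi ->.
by rewrite in_fset_set// mem_set.
Qed.

(** An infinite set contains lists of every length, which forces [c = +oo]. *)
Lemma counting_le A (c : \bar R) :
  (forall s : seq T, uniq s -> (forall x, x \in s -> A x) ->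
    ((size s)%:R%:E <= c)%E) -> (counting A <= c)%E.
Proof.
move=> sc; rewrite /counting; case: asboolP => [finA|infA].
  by apply: sc => [|x]; [exact: fset_uniq|rewrite in_fset_set// => /set_mem].
rewrite leye_eq; apply/eqP/eqyP => M _.
have [B BA nB] := infinite_set_fset (Num.truncn M).+1 infA.
apply: (@le_trans _ _ ((#|` B|)%:R%:E)).
  rewrite lee_fin; apply: ltW; apply: lt_le_trans (truncnS_gt M) _.
  by rewrite ler_nat.
by apply: sc => // x xB; apply: BA.
Qed.

End Counting.

Section SignChanges.
Context {R : realType}.
Variables (a b : R) (h : R -> R).
Hypothesis ab : a < b.
Hypothesis ch : continuous h.

Definition sign_changes n : {set 'I_n} :=
  [set k : 'I_n | h (mesh a b n k) * h (mesh a b n k.+1) < 0].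

(** The product is strictly negative, so the intermediate zero lies in the open piece and distinct
    pieces give distinct zeros. *)
Lemma nb_zeros_ge n : ((#|sign_changes n|%:R)%:E <= nb_zeros h a b)%E.
Proof.
have ex (k : 'I_n) : exists t, k \in sign_changes n ->
    [/\ mesh a b n k < t, t < mesh a b n k.+1 & h t = 0].
  have [|_] := boolP (k \in _); last by exists 0.
  rewrite inE => hk.
  have le1 : mesh a b n k <= mesh a b n k.+1 by rewrite mesh_le// ltW.
  have cw : {within `[mesh a b n k, mesh a b n k.+1], continuous h}.
    exact: continuous_subspaceT.
  have [|t] := IVT (v := 0) le1 cw.
    rewrite ge_min le_max; have [h0|h0] := ltP (h (mesh a b n k)) 0.
      by rewrite (ltW h0)/=; move: hk; rewrite nmulr_rlt0// => /ltW ->; rewrite ?orbT.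
    rewrite /= ?andbT; apply/orP; right; rewrite leNgt; apply/negP => h1.
    by move: hk; rewrite ltNge mulr_ge0// ltW.
  rewrite in_itv/= => /andP[t1 t2] ht; exists t => _; split=> //.
    rewrite lt_neqAle t1 andbT; apply/eqP => E.
    by move: hk; rewrite E ht mul0r ltxx.
  rewrite lt_neqAle t2 andbT; apply/eqP => E.
  by move: hk; rewrite -E ht mulr0 ltxx.
have [z zP] := choice ex.
apply: (@counting_ge_inj _ _ _ _ z) => [i j /zP[i1 i2 _] /zP[j1 j2 _] zij|k kS].
  apply/val_inj/eqP; rewrite /= eqn_leq -!(ltnS (val _)).
  have ab' := ltW ab.
  apply/andP; split; rewrite ltnNge; apply/negP => /(mesh_le n ab').
    by move=> le; move: i1; rewrite zij; lra.
  by move=> le; move: j1; rewrite -zij; lra.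
have [z1 z2 hz] := zP k kS; split=> //.
rewrite in_itv/=; apply/andP; split.
  have /andP[+ _] := @mesh_itv _ a b n k (ltW ab) (ltnW (ltn_ord k)); lra.
have /andP[_] := @mesh_itv _ a b n k.+1 (ltW ab) (ltn_ord k); lra.
Qed.

(** When [i <= j], the index [k.+1] is the first one whose sign is opposite to that at [i]. *)
Lemma sign_change_between (f : nat -> R) i j : f i * f j < 0 ->
  (forall k, (minn i j <= k <= maxn i j)%N -> f k != 0) ->
  exists2 k, (minn i j <= k < maxn i j)%N & f k * f k.+1 < 0.
Proof.
wlog ij : i j / (i <= j)%N => [H fij fn0|].
  case/orP: (leq_total i j) => ij; first exact: H.
  have [|k|k kij fk] := H j i ij; first by rewrite mulrC.
    by rewrite minnC maxnC; exact: fn0.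
  by exists k => //; rewrite minnC maxnC.
rewrite (minn_idPl ij) (maxn_idPr ij) => fij fn0.
have ex : exists k, (i <= k)%N && (f i * f k < 0) by exists j; rewrite ij.
case: (ex_minnP ex) => -[|k] /andP[ik fk] kmin.
  move: ik fk; rewrite leqn0 => /eqP -> ; rewrite -expr2 ltNge sqr_ge0//.
have kj : (k.+1 <= j)%N by apply: kmin; rewrite ij.
have ik' : (i <= k)%N.
  move: ik; rewrite leq_eqVlt ltnS => /predU1P[ik|//].
  by move: fk; rewrite -ik -expr2 ltNge sqr_ge0.
exists k; first by rewrite ik'.
have fi : f i != 0 by apply: fn0; rewrite leqnn.
have fkn : f k != 0 by apply: fn0; rewrite ik' ltnW.
have fik : 0 < f i * f k.
  rewrite lt_neqAle eq_sym mulf_neq0//= leNgt; apply/negP => fk'.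
  by have := kmin k; rewrite ik' fk' ltnn => /(_ isT).
have : (f i * f i) * (f k * f k.+1) < 0.
  rewrite (_ : _ * _ = (f i * f k) * (f i * f k.+1)); last by ring.
  by rewrite pmulr_rlt0.
by rewrite pmulr_rlt0// -expr2 lt_neqAle sqr_ge0 andbT eq_sym sqrf_eq0.
Qed.

Hypothesis mesh_neq0 : forall n k, h (mesh a b n k) != 0.
Variable n0 : nat.
(** Only the countably many pieces of the meshes occur, so that for random paths the exceptional
    event is a countable union. Coarse meshes are left out because the correlation is bounded below
    only over short steps. *)
Hypothesis not_tangent : forall e n k, `|e| = 1 -> (n0 <= n)%N -> (k < n)%N ->
  ~ (exists2 t, mesh a b n k <= t <= mesh a b n k.+1 &
      h t = 0 /\ forall u, mesh a b n k <= u <= mesh a b n k.+1 -> e * h u <= 0).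

Let mesh_size (e : R) : 0 < e -> \forall n \near \oo, (b - a) / n.+1%:R < e.
Proof.
move=> e0; apply: (cvgr_lt (0 : R)) => //.
rewrite -[X in _ --> X](mulr0 (b - a)).
by apply: cvgMl_tmp; exact: cvg_harmonic.
Qed.

Let opposite_signs_near_zero t (e : R) : 0 < e -> a <= t <= b -> h t = 0 ->
  exists x y, [/\ a <= x <= b, a <= y <= b, `|x - t| < e, `|y - t| < e &
    0 < h x /\ h y < 0].
Proof.
move=> e0 tab ht.
have [M _ /(_ _ (leq_maxl _ _)) hM] := mesh_size e0.
pose n := (maxn M n0).+1.
have {}hM : (b - a) / n%:R < e by exact: (hM n0).
have n0n : (n0 <= n)%N by rewrite /n leqW// leq_maxr.
have [k kn tk] := @mesh_bracket _ a b n t isT tab.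
have pick (s : R) : `|s| = 1 -> exists x, [/\ a <= x <= b, `|x - t| < e & 0 < s * h x].
  move=> s1.
  have := not_tangent s1 n0n kn.
  move/forall2NP => /(_ t)[//|] /not_andP[//|].
  move=> /existsNP[x] /not_implyP[xk /negP]; rewrite -ltNge => sx.
  exists x; split=> //.
    have /andP[+ _] := @mesh_itv _ a b n k (ltW ab) (ltnW kn).
    have /andP[_] := @mesh_itv _ a b n k.+1 (ltW ab) kn.
    by move: xk => /andP[? ?] ? ?; apply/andP; split; lra.
  move: tk xk; rewrite meshS => /andP[? ?] /andP[? ?].
  by rewrite ltr_norml; apply/andP; split; lra.
have [x [xab xt hx]] := pick 1 (normr1 _).
have [y [yab yt hy]] := pick (-1) (etrans (normrN1 _) erefl).
exists x, y; split=> //; split; first by rewrite -[h x]mul1r.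
by move: hy; rewrite mulN1r oppr_gt0.
Qed.

Let mesh_near_point x : a <= x <= b -> h x != 0 ->
  forall e : R, 0 < e -> \forall n \near \oo, exists2 k, (k <= n.+1)%N &
    `|mesh a b n.+1 k - x| < e /\ 0 < h x * h (mesh a b n.+1 k).
Proof.
move=> xab hx e e0.
have hx0 : 0 < `|h x| by rewrite normr_gt0.
have /cvgrPdist_lt /(_ _ hx0) [dl /= dl0 near_x] := @ch x.
have := mesh_size (e := Num.min e dl); rewrite lt_min e0 dl0 => /(_ isT).
apply: filterS => n; rewrite lt_min => /andP[small1 small2].
have [k kn /andP[k1 k2]] := @mesh_bracket _ a b n.+1 x isT xab.
move: k2 small1 small2; rewrite meshS; set D := (b - a) / _ => k2 small1 small2.
exists k; first exact: ltnW.
split; first by rewrite ltr_norml; apply/andP; split; lra.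
have /near_x : `|x - mesh a b n.+1 k| < dl by rewrite ltr_norml; apply/andP; split; lra.
have [h0|h0|h0] := ltgtP (h x) 0; last by rewrite h0 eqxx in hx.
  by rewrite (ltr0_norm h0) ltr_norml nmulr_rgt0// => /andP[? ?]; lra.
by rewrite (gtr0_norm h0) ltr_norml pmulr_rgt0// => /andP[? ?]; lra.
Qed.

(** Absence of tangency gives points of both signs within [e / 2] of [t]; mesh points within [e / 2]
    of these share their signs, and a change of sign between two such mesh points stays within [e]
    of [t]. *)
Lemma sign_change_near_zero t (e : R) : 0 < e -> a <= t <= b -> h t = 0 ->
  \forall n \near \oo, exists2 k : 'I_n.+1, k \in sign_changes n.+1 &
    `|mesh a b n.+1 k - t| < e.
Proof.
move=> e0 tab ht.
have e20 : 0 < e / 2 by rewrite divr_gt0.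
have [x [y [xab yab xt yt [hx hy]]]] := opposite_signs_near_zero e20 tab ht.
have hxn : h x != 0 by rewrite gt_eqF.
have hyn : h y != 0 by rewrite lt_eqF.
have := mesh_near_point yab hyn e20; have := mesh_near_point xab hxn e20.
apply: filterS2 => n [i i_n [ix hi]] [j j_n [jy hj]].
have hij : h (mesh a b n.+1 i) * h (mesh a b n.+1 j) < 0.
  by move: hi hj; rewrite pmulr_rgt0// nmulr_rgt0// => ? ?; rewrite pmulr_rlt0.
have [k /andP[ik kj] hk] := sign_change_between hij (fun k _ => mesh_neq0 _ _).
have kn : (k < n.+1)%N by apply: leq_trans kj _; rewrite geq_max i_n.
exists (Ordinal kn); first by rewrite inE.
rewrite /=.
have le1 := mesh_le n.+1 (ltW ab) ik; have le2 := mesh_le n.+1 (ltW ab) (ltnW kj).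
move: ix jy xt yt; rewrite !ltr_norml => /andP[? ?] /andP[? ?] /andP[? ?] /andP[? ?].
move: le1 le2; rewrite /minn /maxn; case: ltnP => _ le1 le2; apply/andP; split; lra.
Qed.

Lemma uniq_separated (s : seq R) : uniq s -> exists2 e : R, 0 < e &
  {in s &, forall x y, `|x - y| < e -> x = y}.
Proof.
elim: s => [|t s ih] /=; first by exists 1.
move=> /andP[ts us]; have [e e0 es] := ih us.
have [e' e'0 et] : exists2 e' : R, 0 < e' & {in s, forall x, e' <= `|x - t|}.
  elim: s ts {ih us es} => [|x s ih]; first by exists 1.
  rewrite inE negb_or => /andP[tx /ih[e' e'0 et]].
  exists (Num.min e' `|x - t|).
    by rewrite lt_min e'0 normr_gt0 subr_eq0 eq_sym.
  move=> y; rewrite inE => /predU1P[->|/et]; rewrite ge_min ?lexx ?orbT//.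
  by move=> ->.
exists (Num.min e e'); first by rewrite lt_min e0.
move=> x y; rewrite !inE => /predU1P[->|xs] /predU1P[->|ys] //; rewrite lt_min => /andP[xe xe'].
- by move: xe'; rewrite distrC ltNge et.
- by move: xe'; rewrite ltNge et.
- exact: es.
Qed.

(** Each zero is sent to a piece starting within half the minimal separation of the zeros, so no two
    zeros share a piece. *)
Lemma zeros_le_sign_changes (s : seq R) : uniq s ->
  (forall t, t \in s -> t \in `[a, b] /\ h t = 0) ->
  \forall n \near \oo, (size s <= #|sign_changes n.+1|)%N.
Proof.
move=> us s0; have [e e0 es] := uniq_separated us.
have e20 : 0 < e / 2 by rewrite divr_gt0.
have : \forall n \near \oo, forall t, t \in s -> exists2 k : 'I_n.+1,
    k \in sign_changes n.+1 & `|mesh a b n.+1 k - t| < e / 2.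
  elim: s s0 {us es} => [|t s ih] s0; first by apply: nearW => n t; rewrite in_nil.
  have [|tab ht] := s0 t; first by rewrite mem_head.
  move: tab; rewrite in_itv/= => tab.
  have := ih (fun u us => s0 u (mem_behead (s := t :: s) us)).
  have := sign_change_near_zero e20 tab ht.
  by apply: filterS2 => n ht' hs u; rewrite inE => /predU1P[->|/hs].
apply: filterS => n hn.
(* The search returns an option, so no default piece has to be chosen for points outside [s]. *)
pose kap t := [pick k | (k \in sign_changes n.+1) && (`|mesh a b n.+1 k - t| < e / 2)].
have kapP t : t \in s -> exists2 k, kap t = Some k &
    k \in sign_changes n.+1 /\ `|mesh a b n.+1 k - t| < e / 2.
  move=> /hn[k kS kt]; rewrite /kap; case: pickP => [k' /andP[? ?]|/(_ k)]; first by exists k'.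
  by rewrite kS kt.
rewrite cardE -(size_map Some (enum _)) -(size_map kap s); apply: uniq_leq_size.
  rewrite map_inj_in_uniq// => x y xs ys E; apply: es => //.
  have [k xk [_ kx]] := kapP x xs; have [k' yk [_ ky]] := kapP y ys.
  have kk : k = k' by move: E; rewrite xk yk => -[].
  move: kx ky; rewrite -kk !ltr_norml => /andP[? ?] /andP[? ?].
  by apply/andP; split; lra.
move=> y /mapP[t /kapP[k tk [kS _]] ->]; rewrite tk map_f// mem_enum//.
Qed.

End SignChanges.

(** * The Rice formula *)

Section NonMeasurableIntegrand.
Context {d : measure_display} {T : measurableType d} {R : realType}.
Variable mu : {measure set T -> \bar R}.
Import HBNNSimple.
Local Open Scope ereal_scope.

(** The integral of a nonnegative function is the supremum over the simple functions below it, so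
    monotonicity holds without measurability. *)
Lemma ge0_le_integralT (f g : T -> \bar R) : (forall x, 0 <= f x) ->
  (forall x, f x <= g x) -> \int[mu]_x f x <= \int[mu]_x g x.
Proof.
move=> f0 fg; have g0 x : 0 <= g x by exact: le_trans (fg x).
rewrite !ge0_integralTE//; apply: ge_ereal_sup => _ [h hf <-].
by apply: ereal_sup_ubound; exists h => // x; exact: le_trans (hf x) _.
Qed.

(** An almost everywhere bound is applied to each simple function below [f]; the integrals then
    compared are those of a simple function and of the measurable [g]. *)
Lemma ae_le_integralT (f g : T -> \bar R) : (forall x, 0 <= f x) ->
  (forall x, 0 <= g x) -> measurable_fun setT g ->
  {ae mu, forall x, f x <= g x} -> \int[mu]_x f x <= \int[mu]_x g x.
Proof.
move=> f0 g0 mg fg.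
rewrite ge0_integralTE//; apply: ge_ereal_sup => _ [h hf <-].
rewrite -integralT_nnsfun; apply: ae_ge0_le_integral => //.
- by move=> x _; rewrite lee_fin; exact: fun_ge0.
- exact/measurable_EFinP.
- by apply: filterS fg => x fgx _; exact: le_trans (hf x) fgx.
Qed.

End NonMeasurableIntegrand.

Lemma limn_einf_ge {R : realType} (u : (\bar R)^nat) (c : \bar R) :
  (\forall n \near \oo, (c <= u n)%E) -> (c <= limn_einf u)%E.
Proof.
move=> [N _ cu]; rewrite limn_einf_lim.
apply: lime_ge; first exact: is_cvg_einfs.
exists N => // n /= Nn; apply: le_ereal_inf_tmp => _ [m /= nm <-].
by apply: cu => /=; exact: leq_trans nm.
Qed.

Lemma nb_zeros_ge0 {R : realType} (h : R -> R) (a b : R) :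
  (0 <= nb_zeros h a b)%E.
Proof.
by rewrite /nb_zeros /counting; case: asboolP => _; rewrite ?lee_fin ?leey.
Qed.

Section Rice.
Context {d : measure_display} {Omega : measurableType d} {R : realType}.
Variables (P : probability Omega R) (X : R -> {RV P >-> R}) (r : R -> R).
Hypothesis X_gaussian : gaussian_process X.
Hypothesis X_centered : centered X.
Hypothesis X_paths : continuous_paths X.
Hypothesis X_cov :
  forall s t : R, ('E_P[fun w => (X s w * X t w)%R] = (r (t - s))%:E)%E.
Hypothesis r0 : 0 < r 0.
Variable kappa : R.
Hypothesis kappa0 : 0 < kappa.
Hypothesis r_asym : (r 0 - r u) / u ^+ 2 @[u --> 0^'+] --> kappa.
Local Notation sigma := (Num.sqrt (r 0)).
Let sigma0 : 0 < sigma. Proof. by rewrite sqrtr_gt0. Qed.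

Let mX u : measurable_fun setT (X u : Omega -> R).
Proof. exact: measurable_process. Qed.

Let correlation_near0 : exists2 dl, 0 < dl &
  forall u, 0 <= u <= dl -> 2^-1 <= r u / r 0.
Proof.
have [e /= e0 he] : \forall u \near 0^'+, (r 0 - r u) / u ^+ 2 < kappa + 1.
  by apply: (cvgr_lt _ r_asym); rewrite ltrDl.
(* The three bounds keep [u] inside the neighbourhood, give [u ^ 2 <= u], and then
   [(kappa + 1) * u ^ 2 <= r 0 / 2]. *)
pose dl := Num.min (e / 2) (Num.min 1 (r 0 / (2 * (kappa + 1)))).
have k1 : 0 < kappa + 1 by rewrite addr_gt0.
have dl0 : 0 < dl by rewrite !lt_min !divr_gt0 ?mulr_gt0//= ltr01.
exists dl => // u /andP[]; rewrite le_eqVlt => /predU1P[<- _|u0 udl].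
  by rewrite divff ?gt_eqF// invf_le1// ler1n.
move: udl; rewrite !le_min => /andP[ue /andP[u1 ur]].
have := he u; rewrite /= sub0r normrN gtr0_norm// => /(_ _ u0).
rewrite (le_lt_trans ue) => [/(_ isT)|]; last by rewrite ltr_pdivrMr// ltr_pMr// ltr1n.
rewrite ltr_pdivrMr ?exprn_gt0// => h.
rewrite ler_pdivlMr//.
have : (kappa + 1) * u ^+ 2 <= r 0 / 2.
  have -> : r 0 / 2 = (kappa + 1) * (1 * (r 0 / (2 * (kappa + 1)))).
    by field; rewrite gt_eqF.
  by rewrite ler_wpM2l ?(ltW k1)// expr2 ler_pM ?(ltW u0).
lra.
Qed.

Section Interval.
Variables a b : R.
Hypothesis ab : a < b.

Let h n := (b - a) / n.+1%:R.
Let h0 n : 0 < h n. Proof. by rewrite divr_gt0// subr_gt0. Qed.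
Let N n w := #|sign_changes a b (fun t => X t w) n.+1|%:R : R.

Let cvg_h : h n @[n --> \oo] --> (0 : R).
Proof.
rewrite -[X in _ --> X](mulr0 (b - a)); apply: cvgMl_tmp; exact: cvg_harmonic.
Qed.

Let E n (k : 'I_n.+1) :=
  [set w | X (mesh a b n.+1 k) w * X (mesh a b n.+1 k.+1) w < 0].

Let mE n k : measurable (@E n k).
Proof.
have m : measurable_fun setT
    (fun w => (X (mesh a b n.+1 k) w : R) * X (mesh a b n.+1 k.+1) w).
  exact: measurable_funM.
rewrite (_ : E k = setT `&` (fun w => (X (mesh a b n.+1 k) w : R) *
    X (mesh a b n.+1 k.+1) w) @^-1` `]-oo, 0[%classic).
  exact: m.
by rewrite setTI; apply/seteqP; split=> w; rewrite /= in_itv.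
Qed.

Let NE n w : N n w = \sum_(k < n.+1) \1_(@E n k) w.
Proof.
rewrite /N -sum1_card natr_sum big_mkcond/=; apply: eq_bigr => k _.
by rewrite indicE inE /=; case: ifPn => hk; [rewrite mem_set|rewrite memNset//; exact/negP].
Qed.

Let mN n : measurable_fun setT (EFin \o N n).
Proof.
apply/measurable_EFinP; rewrite (_ : N n = fun w => \sum_(k < n.+1) \1_(@E n k) w).
  by apply: measurable_sum => k; exact: measurable_indic.
by apply/funext => w; exact: NE.
Qed.

Let EN n : (\int[P]_w (N n w)%:E = \sum_(k < n.+1) P (@E n k))%E.
Proof.
transitivity (\int[P]_w (\sum_(k < n.+1) (\1_(@E n k) w)%:E))%E.
  by apply: eq_integral => w _; rewrite NE sumEFin.
rewrite ge0_integral_sum//.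
- by apply: eq_bigr => k _; rewrite integral_indic// setIT.
- by move=> k; apply/measurable_EFinP; exact: measurable_indic.
Qed.

Let up x := Num.sqrt ((r 0 - r x) * (r 0 + r x) / r 0) / (pi * sigma * (r x / r 0)).
Let low x := up x - normal_peak sigma *
  (Num.sqrt ((r 0 - r x) * (r 0 + r x) / r 0)) ^+ 2 / ((r x / r 0) ^+ 2 * sigma).
Let lim := (b - a) / pi * Num.sqrt (2 * (kappa / r 0)).

(** The deviation of the residual over one step is [h n * S n], where [q n] tends to [kappa] and
    [S n] to [sqrt (2 kappa)]; this isolates the factor [h n] that cancels the number of pieces. *)
Let q n := (r 0 - r (h n)) / h n ^+ 2.
Let S n := Num.sqrt (q n * (r 0 + r (h n)) / r 0).

Let cvg_q : q n @[n --> \oo] --> kappa.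
Proof. exact: ((cvg_at_rightP _ _ _).1 r_asym h (conj h0 cvg_h)). Qed.

Let qE n : r 0 - r (h n) = q n * h n ^+ 2.
Proof. by rewrite /q divfK// expf_neq0// gt_eqF. Qed.

Let cvg_r : r (h n) @[n --> \oo] --> r 0.
Proof.
rewrite (_ : (fun n => r (h n)) = fun n => r 0 - q n * (h n * h n)); last first.
  by apply/funext => n; rewrite -expr2 -qE subKr.
rewrite -[X in _ --> X]subr0 -[X in _ - X](mulr0 kappa) -[X in kappa * X](mulr0 0).
apply: cvgB; first exact: cvg_cst.
by apply: cvgM; [exact: cvg_q|apply: cvgM; exact: cvg_h].
Qed.

Let cvg_S2 : q n * (r 0 + r (h n)) / r 0 @[n --> \oo] --> kappa * (r 0 + r 0) / r 0.
Proof.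
apply: cvgMr_tmp; apply: cvgM; first exact: cvg_q.
by apply: cvgD; [exact: cvg_cst|exact: cvg_r].
Qed.

Let cvg_S : S n @[n --> \oo] --> Num.sqrt (kappa * (r 0 + r 0) / r 0).
Proof. by apply: continuous_cvg; [exact: sqrt_continuous|exact: cvg_S2]. Qed.

Let cvg_c : (r (h n) / r 0)^-1 @[n --> \oo] --> (1 : R).
Proof.
rewrite -[X in _ --> X]invr1; apply: cvgV; first exact: oner_neq0.
rewrite -[X in _ --> X](divff (x := r 0)) ?gt_eqF//.
by apply: cvgMr_tmp; exact: cvg_r.
Qed.

Let tauE n : Num.sqrt ((r 0 - r (h n)) * (r 0 + r (h n)) / r 0) = h n * S n.
Proof.
rewrite qE (_ : _ / r 0 = h n ^+ 2 * (q n * (r 0 + r (h n)) / r 0)); last by ring.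
by rewrite sqrtrM ?sqr_ge0// sqrtr_sqr gtr0_norm.
Qed.

Let nh n : n.+1%:R * h n = b - a.
Proof. by rewrite /h mulrC divfK// pnatr_eq0. Qed.

Let bounds : \forall n \near \oo,
  ((n.+1%:R * low (h n))%:E <= \int[P]_w (N n w)%:E)%E /\
  (\int[P]_w (N n w)%:E <= (n.+1%:R * up (h n))%:E)%E.
Proof.
have q0 : \forall n \near \oo, 0 < q n by exact: (cvgr_gt _ cvg_q).
have rh0 : \forall n \near \oo, 0 < r (h n) by exact: (cvgr_gt _ cvg_r).
apply: filterS2 q0 rh0 => n q0 rh0.
have rh1 : r (h n) < r 0 by rewrite -subr_gt0 qE mulr_gt0// exprn_gt0.
have sumE (c : R) : (n.+1%:R * c)%:E = (\sum_(k < n.+1) c%:E)%E.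
  have -> : n.+1%:R * c = \sum_(k < n.+1) c by rewrite sumr_const card_ord mulr_natl.
  exact: esym (sumEFin (index_enum _) xpredT (fun=> c)).
have Ebounds k := sign_change_prob_bounds X_gaussian X_centered X_cov r0
  (mesh a b n.+1 k) rh0 rh1.
rewrite EN !sumE; split; apply: lee_sum => k _; have := Ebounds k;
  rewrite -meshS; by case.
Qed.

Let limE : (b - a) * (Num.sqrt (kappa * (r 0 + r 0) / r 0) / (pi * sigma)) = lim.
Proof.
have -> : lim = (b - a) / pi * Num.sqrt ((kappa * (r 0 + r 0) / r 0) * (r 0)^-1).
  by congr (_ * Num.sqrt _); field; rewrite gt_eqF.
have : 0 <= kappa * (r 0 + r 0) / r 0 by rewrite divr_ge0 ?mulr_ge0 ?addr_ge0 ?ltW.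
move: (kappa * _ / _) => x x0.
by rewrite (sqrtrM _ x0) sqrtrV ?(ltW r0)// invfM; ring.
Qed.

Let cvg_up : n.+1%:R * up (h n) @[n --> \oo] --> lim.
Proof.
rewrite -limE (_ : (fun n => _) = fun n =>
    (b - a) * (S n / (pi * sigma) * (r (h n) / r 0)^-1)); last first.
  apply/funext => n; rewrite /up tauE -(nh n).
  by rewrite (invfM (pi * sigma)); ring.
apply: cvgMl_tmp; rewrite -[X in _ --> X]mulr1; apply: cvgM; last exact: cvg_c.
by apply: cvgMr_tmp; exact: cvg_S.
Qed.

Let cvg_low : n.+1%:R * low (h n) @[n --> \oo] --> lim.
Proof.
(* The error of one step is quadratic in [h n]; over all [n.+1] pieces there remains one factor
   [h n], which tends to 0. *)
rewrite (_ : (fun n => _) = fun n => n.+1%:R * up (h n) -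
    normal_peak sigma / sigma * (b - a) *
    (h n * (S n * S n) * ((r (h n) / r 0)^-1 * (r (h n) / r 0)^-1))); last first.
  apply/funext => n; rewrite /low mulrBr tauE -(nh n); congr (_ - _).
  by rewrite (invfM (_ ^+ 2)) -exprVn; ring.
rewrite -[X in _ --> X]subr0; apply: cvgB; first exact: cvg_up.
rewrite -[X in _ --> X](mulr0 (normal_peak sigma / sigma * (b - a))); apply: cvgMl_tmp.
set s := Num.sqrt (kappa * (r 0 + r 0) / r 0).
have E0 : 0 * (s * s) * (1 * 1) = 0 :> R by rewrite !mul0r.
rewrite -[X in _ --> X]E0.
apply: cvgM; last by apply: cvgM; exact: cvg_c.
by apply: cvgM; [exact: cvg_h|apply: cvgM; exact: cvg_S].
Qed.

Let cvg_EN : (\int[P]_w (N n w)%:E)%E @[n --> \oo] --> lim%:E.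
Proof.
apply: (@squeeze_cvge _ _ _ _ (fun n => (n.+1%:R * low (h n))%:E) _
  (fun n => (n.+1%:R * up (h n))%:E)).
- by apply: filterS bounds => n [-> ->].
- by apply: cvg_EFin; [exact: nearW|exact: cvg_low].
- by apply: cvg_EFin; [exact: nearW|exact: cvg_up].
Qed.

(** The exceptional event gathers zeros at mesh points and tangential zeros on pieces of fine
    meshes, for [e = 1] and [e = -1]. Off it, every finite list of zeros is eventually dominated by
    [N n], which covers infinitely many zeros as well. *)
Let nb_zeros_le : {ae P, forall w,
  (nb_zeros (fun t => X t w) a b <= limn_einf (fun n => (N n w)%:E))%E}.
Proof.
have [dl dl0 hdl] := correlation_near0.
have [n0 _ hn0] : \forall n \near \oo, h n < dl by exact: (cvgr_lt _ cvg_h).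
have meshE n k : mesh a b n.+1 k.+1 - mesh a b n.+1 k = h n.
  by rewrite meshS addrAC subrr add0r.
pose Z := \bigcup_n \bigcup_k [set w | X (mesh a b n k) w = 0].
pose tg e n k := [set w | exists2 t, mesh a b n k <= t <= mesh a b n k.+1 &
  X t w = 0 /\ forall u, mesh a b n k <= u <= mesh a b n k.+1 -> e * X u w <= 0].
pose W e := \bigcup_n \bigcup_k [set w | (n0 < n)%N /\ tg e n k w].
have Z0 : P.-negligible Z.
  apply: negligible_bigcup => n; apply: negligible_bigcup => k.
  have Pz := process_neq0 X_gaussian X_centered X_cov r0 (mesh a b n k).
  exists [set w | X (mesh a b n k) w = 0]; split=> //.
  by have := mX (mesh a b n k) measurableT (measurable_set1 0); rewrite setTI.
have W0 e : `|e| = 1 -> P.-negligible (W e).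
  move=> e1; apply: negligible_bigcup => n; apply: negligible_bigcup => k.
  case: n => [|n].
    by apply: negligibleS (negligible_set0 P) => w [].
  (* [h n] is the step of the mesh with [n.+1] pieces, hence the strict inequality. *)
  have [nn|nn] := ltnP n0 n.+1; last first.
    by apply: negligibleS (negligible_set0 P) => w /= [].
  apply: (@negligibleS _ _ _ _ (tg e n.+1 k)) => [w []//|].
  apply: (no_tangency X_gaussian X_centered X_paths X_cov r0 (c0 := 2^-1)) => //.
    by rewrite -subr_gt0 meshE.
  by move=> u; rewrite meshE => /andP[u0 uh]; apply: hdl; rewrite u0 (le_trans uh)// ltW// hn0.
have : P.-negligible (Z `|` (W 1 `|` W (-1))).
  apply: negligibleU => //; apply: negligibleU; apply: W0; rewrite ?normrN1 ?normr1//.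
apply: negligibleS => w /= hw; apply: contrapT => /not_orP[nZ /not_orP[nW1 nW2]].
apply: hw; apply: counting_le => s us s0.
apply: limn_einf_ge.
have cw : continuous (fun t => X t w : R) by exact: X_paths.
have nz n k : X (mesh a b n k) w != 0.
  by apply/eqP => hz; apply: nZ; exists n => //; exists k.
have nt e n k : `|e| = 1 -> (n0.+1 <= n)%N -> (k < n)%N ->
  ~ (exists2 t, mesh a b n k <= t <= mesh a b n k.+1 &
      X t w = 0 /\ forall u, mesh a b n k <= u <= mesh a b n k.+1 -> e * X u w <= 0).
  move=> e1 nn kn ht; have {e1} [e1|e1] : e = 1 \/ e = -1.
    by have [e_ge0|e_lt0] := leP 0 e; [left; rewrite -e1 ger0_norm|
      right; rewrite -e1 ltr0_norm// opprK].
    by apply: nW1; exists n => //; exists k => //; split=> //; rewrite -e1.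
  by apply: nW2; exists n => //; exists k => //; split=> //; rewrite -e1.
have := zeros_le_sign_changes ab cw nz nt us s0.
by apply: filterS => n; rewrite lee_fin ler_nat.
Qed.

Lemma Rice_lt : (\int[P]_w nb_zeros (fun t => X t w) a b = lim%:E)%E.
Proof.
apply/eqP; rewrite eq_le; apply/andP; split.
  apply: (@le_trans _ _ (\int[P]_w limn_einf (fun n => (N n w)%:E))%E).
    apply: ae_le_integralT => //.
    - by move=> w; apply: limn_einf_ge; apply: nearW => n; rewrite lee_fin.
    - apply: measurableT_comp => //.
      apply: (@measurable_fun_limn_esup _ _ _ setT (fun n w => - (N n w)%:E)%E) => n.
      exact: (measurableT_comp (@oppe_measurable R setT) (@mN n)).
  apply: (le_trans (@fatou _ _ _ P setT measurableT (fun n w => (N n w)%:E) _ _)) => //.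
  - by move=> n w _; rewrite lee_fin.
  - by rewrite (cvg_limn_einf_sup cvg_EN).1.
apply: (cvge_le _ cvg_EN); apply: nearW => n.
apply: ge0_le_integralT => w; first by rewrite lee_fin.
apply: nb_zeros_ge => //; exact: X_paths.
Qed.

End Interval.

Theorem Rice a b : a <= b ->
  (\int[P]_w nb_zeros (fun t => X t w) a b =
   ((b - a) / pi * Num.sqrt (2 * (kappa / r 0)))%:E)%E.
Proof.
rewrite le_eqVlt => /predU1P[<-|/Rice_lt//].
rewrite subrr !mul0r.
apply/eqP; rewrite eq_le integral_ge0 ?andbT; last by move=> w _; exact: nb_zeros_ge0.
apply: (@le_trans _ _ (\int[P]_w (cst 0%E w))%E); last by rewrite integral0.
apply: ae_le_integralT => //.
(* On the one-point interval the count can be nonzero only if [X a] vanishes. *)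
have neg : P.-negligible [set w | X a w = 0].
  exists [set w | X a w = 0]; split=> //.
    by have := mX a measurableT (measurable_set1 0); rewrite setTI.
  exact: (process_neq0 X_gaussian X_centered X_cov r0).
apply: (negligibleS _ neg) => w /= hw; apply: contrapT => Xa; apply: hw.
rewrite /nb_zeros (_ : [set t | _] = set0) ?measure0//.
apply/seteqP; split=> // t [].
by rewrite in_itv/= -eq_le => /eqP <-.
Qed.

End Rice.

(** * The autocorrelation of a piecewise C1 function *)

Section PiecewiseC1.
Context {R : realType}.
Variable f : R -> R.
Hypothesis f_cont : continuous f.

(** [f] agrees with [g] only on [[c, d[]. The bound is carried up to [d] by the mean value theorem
    for [f] itself, which is continuous there, with [g'] bounded on the compact [[c, d]]. *)
Lemma C1_piece (g : R -> R) (c d : R) : c < d -> C1_on g c d ->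
  (forall x, x \in `[c, d[ -> f x = g x) ->
  (forall x, c < x < d -> derivable f x 1) /\
  exists2 L, 0 <= L & forall x y, c <= x -> x <= y -> y <= d -> `|f y - f x| <= L * (y - x).
Proof.
move=> cd [g' [cg' gg']] fg.
have der x : c < x < d -> is_derive x 1 f (g' x).
  move=> /andP[cx xd].
  have xcd : x \in `[c, d] by rewrite in_itv/= !ltW.
  have fgx : f x = g x by apply: fg; rewrite in_itv/= (ltW cx).
  have lim : h^-1 *: (f (h *: 1 + x) - f x) @[h --> 0^'] --> g' x.
    apply/cvgrPdist_lt => e e0.
    have /cvgrPdist_lt /(_ e e0) [dl /= dl0 hdl] := gg' x xcd.
    near=> h.
    have h0 : h != 0 by near: h; exact: nbhs_dnbhs_neq.
    have hdl' : `|h| < dl by near: h; exact: dnbhs0_lt.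
    have hxc : `|h| < x - c by near: h; apply: dnbhs0_lt; rewrite subr_gt0.
    have hdx : `|h| < d - x by near: h; apply: dnbhs0_lt; rewrite subr_gt0.
    have /andP[? ?] : - (x - c) < h < x - c by rewrite -ltr_norml.
    have /andP[? ?] : - (d - x) < h < d - x by rewrite -ltr_norml.
    rewrite /GRing.scale/= mulr1 fgx fg; last by rewrite in_itv/=; apply/andP; split; lra.
    have := hdl (h + x); rewrite /= opprD addrCA subrr addr0 normrN => /(_ hdl').
    rewrite addrK [X in g' x - X]mulrC; apply.
      by rewrite -subr_eq0 addrK.
    by rewrite /= in_itv/=; apply/andP; split; lra.
  have dv : derivable f x 1 by apply/cvg_ex; exists (g' x).
  by apply: DeriveDef => //; exact/cvg_lim.
split=> [x /der|]; first by case.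
have [M M0 gM] : exists2 M, 0 <= M & forall x, x \in `[c, d] -> `|g' x| <= M.
  have /compact_bounded[M [_ hM]] := continuous_compact cg' (@segment_compact R c d).
  exists (`|M| + 1) => [|x xcd]; first by rewrite addr_ge0.
  by apply: (hM (`|M| + 1)); [rewrite (le_lt_trans (ler_norm M)) ?ltrDl|exists x].
exists M => // x y cx; rewrite le_eqVlt => /predU1P[<- _|xy yd].
  by rewrite !subrr normr0 mulr0.
have [z zxy ->] := MVT xy (fun z (hz : z \in `]x, y[) =>
  der z (introT andP (conj (le_lt_trans cx (proj1 (andP hz))) (lt_le_trans (proj2 (andP hz)) yd))))
  (continuous_subspaceT f_cont).
rewrite normrM (gtr0_norm (x := y - x)) ?subr_gt0// ler_wpM2r ?subr_ge0 ?(ltW xy)//.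
apply: gM; move: zxy; rewrite !in_itv/= => /andP[? ?]; apply/andP; split; lra.
Unshelve. all: by end_near. Qed.

Hypothesis f_pwC1 : piecewise_C1 f.

Lemma piecewise_C1_lipschitz : exists2 L, 0 <= L &
  forall x y, 0 <= x -> x <= y -> y <= 2 * pi -> `|f y - f x| <= L * (y - x).
Proof.
have [n [s [s0 sn sP]]] := f_pwC1.
suff H j : (j <= n)%N -> exists2 L, 0 <= L &
    forall x y, 0 <= x -> x <= y -> y <= s j -> `|f y - f x| <= L * (y - x).
  by have := H n (leqnn n); rewrite sn.
elim: j => [_|j ih jn].
  exists 0 => // x y x0 xy; rewrite s0 => y0.
  have -> : x = y by apply/eqP; rewrite eq_le xy (le_trans y0 x0).
  by rewrite !subrr normr0 mulr0.
have [L L0 hL] := ih (ltnW jn).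
have [sj [g [C1g fg]]] := sP j jn.
have [_ [M M0 hM]] := C1_piece sj C1g fg.
exists (L + M) => [|x y x0 xy ysj]; first exact: addr_ge0.
have [yj|/ltW jy] := leP y (s j).
  by apply: le_trans (hL x y x0 xy yj) _; rewrite ler_wpM2r ?subr_ge0// lerDl.
have [jx|/ltW xj] := leP (s j) x.
  by apply: le_trans (hM x y jx xy ysj) _; rewrite ler_wpM2r ?subr_ge0// lerDr.
rewrite -(subrKA (f (s j))); apply: le_trans (ler_normD _ _) _.
have h1 := hL x (s j) x0 xj (lexx _); have h2 := hM (s j) y (lexx _) jy ysj.
have h3 : M * (y - s j) <= (L + M) * (y - s j) by rewrite ler_wpM2r ?subr_ge0// lerDr.
have h4 : L * (s j - x) <= (L + M) * (s j - x) by rewrite ler_wpM2r ?subr_ge0// lerDl.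
lra.
Qed.

(** The whole range of [s] is excluded, not just the partition points: it is countable, hence still
    a null set. *)
Lemma piecewise_C1_derivable : exists s : nat -> R,
  forall x, 0 <= x <= 2 * pi -> ~ range s x -> derivable f x 1.
Proof.
have [n [s [s0 sn sP]]] := f_pwC1.
exists s => x /andP[x0 x2pi] nS.
have ex : exists j, x <= s j by exists n; rewrite sn.
case: (ex_minnP ex) => -[|j] xj jmin.
  exfalso; apply: nS; exists 0%N => //; apply/eqP.
  by rewrite eq_le s0 x0 -s0 xj.
have jn : (j < n)%N by apply: jmin; rewrite sn.
have [sj [g [C1g fg]]] := sP j jn.
apply: (C1_piece sj C1g fg).1; apply/andP; split.
  by rewrite ltNge; apply/negP => /jmin; rewrite ltnn.
rewrite lt_neqAle xj andbT; apply/eqP => xE.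
by apply: nS; exists j.+1.
Qed.

End PiecewiseC1.

Section Autocorrelation.
Context {R : realType}.
Local Notation mu := (@lebesgue_measure R).
Variable f : R -> R.
Hypothesis f_cont : continuous f.
Hypothesis f_per : periodic f (2 * pi).
Hypothesis f_pwC1 : piecewise_C1 f.

Local Notation D := `[0 : R, 2 * pi]%classic.
Local Notation C := (conv f (reflect_fun f)).

Let pi20 : 0 < 2 * pi :> R. Proof. by rewrite mulr_gt0// pi_gt0. Qed.

Lemma continuous_itv_integrable (g : R -> R) (a b : R) : continuous g ->
  mu.-integrable `[a, b] (EFin \o g).
Proof.
move=> cg; apply: continuous_compact_integrable; first exact: segment_compact.
exact: continuous_subspaceT.
Qed.

Let shift_cont (x : R) : continuous (fun u => f (u - x)).
Proof.
move=> u; apply: (@continuous_comp _ _ _ (fun u => u - x) f).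
  by apply: cvgB; [exact: cvg_id|exact: cvg_cst].
exact: f_cont.
Qed.

Lemma Rintegral_shift (g : R -> R) (a b x : R) : continuous g -> a <= b ->
  \int[mu]_(u in `[a, b]) g (u - x) = \int[mu]_(u in `[a - x, b - x]) g u.
Proof.
move=> cg ab.
have dF : derive1 (fun u : R => u - x) = cst 1.
  by apply/funext => u; rewrite derive1E derive_val subr0.
rewrite /Rintegral.
rewrite (@integration_by_substitution_increasing _ (fun u => u - x) g a b)//.
- by congr fine; apply: eq_integral => u _; rewrite dF /= mulr1.
- by move=> u v _ _; rewrite ltrD2r.
- by rewrite dF => u _; exact: cvg_cst.
- by rewrite dF; exact: is_cvg_cst.
- by rewrite dF; exact: is_cvg_cst.
- have cF : continuous (fun u : R => u - x).
    by move=> u; apply: cvgB; [exact: cvg_id|exact: cvg_cst].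
  split; first by move=> u _; exact: ex_derive.
    by apply: cvg_at_right_filter; exact: cF.
  by apply: cvg_at_left_filter; exact: cF.
- exact: continuous_subspaceT.
Qed.

Lemma Rintegral_periodic_shift (g : R -> R) (x : R) : continuous g ->
  periodic g (2 * pi) -> 0 <= x <= 2 * pi ->
  \int[mu]_(u in D) g (u - x) = \int[mu]_(u in D) g u.
Proof.
move=> cg pg /andP[x0 x2].
rewrite Rintegral_shift ?(ltW pi20)// sub0r.
have split_at a b c : a <= b -> b <= c ->
    \int[mu]_(u in `[a, c]) g u =
    \int[mu]_(u in `[a, b]) g u + \int[mu]_(u in `[b, c]) g u.
  move=> ab bc; have ig := continuous_itv_integrable a c cg.
  have := Rintegral_itvB (a := BLeft a) (b := BRight c) (x := b) ig.
  rewrite !bnd_simp => /(_ ab bc) E.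
  have ibc : mu.-integrable `]b, c] (EFin \o g).
    by apply: integrableS ig => //; apply: subset_itvr; rewrite bnd_simp.
  by rewrite -(Rintegral_itv_obnd_cbnd ibc) -E; ring.
(* Periodicity carries the part over [[- x, 0]] to [[2 pi - x, 2 pi]]. *)
rewrite (split_at (- x) 0); [|by rewrite oppr_le0|by rewrite subr_ge0].
rewrite [RHS](split_at 0 (2 * pi - x)); [|by rewrite subr_ge0|by rewrite gerBl].
rewrite addrC; congr (_ + _).
have := Rintegral_shift (2 * pi) cg (_ : 2 * pi - x <= 2 * pi); rewrite gerBl => /(_ x0).
rewrite subrr addrAC subrr add0r => <-; apply: eq_Rintegral => u _.
by rewrite -(pg (u - _)) subrK.
Qed.

(* Polarization and periodicity turn the autocorrelation into a mean square
   increment. *)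
Lemma autocorrelation_increment (x : R) : 0 <= x <= 2 * pi ->
  C 0 - C x = (2 * pi)^-1 * (2^-1 * \int[mu]_(u in D) (f u - f (u - x)) ^+ 2).
Proof.
move=> x02.
have CE y : C y = (2 * pi)^-1 * \int[mu]_(u in D) (f u * f (u - y)).
  rewrite /conv; congr (_ * _); apply: eq_Rintegral => u _.
  by rewrite /reflect_fun opprB.
have sqf : \int[mu]_(u in D) (f (u - x) * f (u - x)) = \int[mu]_(u in D) (f u * f u).
  apply: (@Rintegral_periodic_shift (fun u => f u * f u)) => //.
    by move=> u; apply: cvgM; exact: f_cont.
  by move=> u; rewrite /= !f_per.
rewrite !CE -mulrBr; congr (_ * _).
have c1 : continuous (fun u => f u * f u) by move=> u; apply: cvgM; exact: f_cont.
have c2 : continuous (fun u => f u * f (u - x)).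
  by move=> u; apply: cvgM; [exact: f_cont|exact: shift_cont].
have c3 : continuous (fun u => f (u - x) * f (u - x)).
  by move=> u; apply: cvgM; exact: shift_cont.
have i1 := continuous_itv_integrable 0 (2 * pi) c1.
have i2 := continuous_itv_integrable 0 (2 * pi) c2.
have i3 := continuous_itv_integrable 0 (2 * pi) c3.
have -> : \int[mu]_(u in D) (f u - f (u - x)) ^+ 2 =
    \int[mu]_(u in D) ((f u * f u + f (u - x) * f (u - x))
      - (f u * f (u - x) + f u * f (u - x))).
  by apply: eq_Rintegral => u _; ring.
rewrite RintegralB//; [|by have := integrableD _ i1 i3; apply|by have := integrableD _ i2 i2; apply].
rewrite !RintegralD// sqf.
under [X in X - _]eq_Rintegral do rewrite subr0.
by field.
Qed.

End Autocorrelation.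

Lemma measurable_subset_range {R : realType} (s : nat -> R) (A : set R) :
  A `<=` range s -> measurable A.
Proof.
move=> As; rewrite (_ : A = \bigcup_(j in [set j | A (s j)]) [set s j]).
  by apply: bigcup_measurable => j _; exact: measurable_set1.
apply/seteqP; split=> [x Ax|_ [j /= Aj] -> //].
by have [j _ jx] := As x Ax; exists j; rewrite /= ?jx.
Qed.

Section CovarianceAsymptotics.
Context {R : realType}.
Local Notation mu := (@lebesgue_measure R).
Variable f : R -> R.
Hypothesis f_cont : continuous f.
Hypothesis f_per : periodic f (2 * pi).
Hypothesis f_pwC1 : piecewise_C1 f.

Local Notation D := `[0 : R, 2 * pi]%classic.
Local Notation C := (conv f (reflect_fun f)).
Local Notation d2 := (inner (derive1 f) (derive1 f)).

Let pi20 : 0 < 2 * pi :> R. Proof. by rewrite mulr_gt0// pi_gt0. Qed.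

(** When [u - x] is negative the path from [u] to [u - x] wraps around the period: it has length [u]
    down to 0, then [x - u] below [2 pi], so the constant is unchanged. *)
Lemma periodic_increment : exists2 L, 0 <= L & forall u x,
  0 <= u <= 2 * pi -> 0 <= x <= 2 * pi -> `|f u - f (u - x)| <= L * x.
Proof.
have [L L0 hL] := piecewise_C1_lipschitz f_cont f_pwC1.
exists L => // u x /andP[u0 u2] /andP[x0 x2].
have [ux|/ltW ux] := leP 0 (u - x).
  apply: le_trans (hL (u - x) u ux _ u2) _; first by rewrite gerBl.
  by rewrite subKr.
have f0 : f 0 = f (2 * pi) by rewrite -[in RHS](add0r (2 * pi)) f_per.
have h1 := hL 0 u (lexx _) u0 u2.
have h2 := hL (u - x + 2 * pi) (2 * pi).
have {}h2 : `|f (2 * pi) - f (u - x + 2 * pi)| <= L * (2 * pi - (u - x + 2 * pi)).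
  by apply: h2; lra.
rewrite f_per -f0 in h2.
rewrite -(subrKA (f 0)); apply: le_trans (ler_normD _ _) _.
by apply: le_trans (lerD h1 h2) _; rewrite -mulrDr ler_wpM2l//; lra.
Qed.

(** The mean square increment divided by [x ^ 2] is the integral of a squared difference quotient,
    which converges to the squared derivative off a countable set and is dominated by the square of
    the Lipschitz constant. *)
Lemma cvg_autocorrelation : (C 0 - C x) / x ^+ 2 @[x --> 0^'+] --> d2 / 2.
Proof.
apply/cvg_at_rightP => h [h0 hlim].
have [N _ hN] : \forall n \near \oo, h n < 2 * pi by exact: (cvgr_lt _ hlim).
(* The increment formula holds for shifts of at most one period, so the first terms are dropped. *)
pose k n := h (n + N)%N.
have k0 n : 0 < k n by exact: h0.
have k2 n : k n <= 2 * pi by apply: ltW; apply: hN; rewrite /= leq_addl.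
have klim : k n @[n --> \oo] --> (0 : R) by rewrite (cvg_shiftn N).
rewrite -(cvg_shiftn N) /=.
have [s ds] := piecewise_C1_derivable f_cont f_pwC1.
have [L L0 hL] := periodic_increment.
pose E := D `\` range s.
have ms : measurable (range s) by apply: (@measurable_subset_range _ s).
have mE : measurable E by exact: measurableD.
have s0 : mu (range s) = 0%E.
  apply: countable_lebesgue_measure0.
  exact: (card_le_trans (card_image_le _ _)).
pose q n u := (f u - f (u - k n)) / k n.
have cq n : continuous (q n).
  move=> u; apply: cvgM; last exact: cvg_cst.
  apply: cvgB; first exact: f_cont.
  apply: (@continuous_comp _ _ _ (fun u => u - k n) f); last exact: f_cont.
  by apply: cvgB; [exact: cvg_id|exact: cvg_cst].
have cq2 n : continuous (fun u => q n u ^+ 2).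
  by move=> u; apply: (@continuous_comp _ _ _ (q n) (fun y => y ^+ 2));
     [exact: cq|exact: exprn_continuous].
have qlim u : E u -> q n u @[n --> \oo] --> derive1 f u.
  move=> [Du nsu].
  have /cvg_ex[l fl] : derivable f u 1.
    by apply: ds => //; move: Du; rewrite /= in_itv.
  have -> : derive1 f u = l.
    by rewrite derive1E; apply/cvg_lim.
  have kn : (forall n, - k n != 0) /\ - k n @[n --> \oo] --> (0 : R).
    split=> [n|]; first by rewrite oppr_eq0 gt_eqF.
    by rewrite -[X in _ --> X]oppr0; apply: cvgN.
  have := (cvgr_dnbhsP _ _ _).1 fl _ kn.
  apply: cvg_trans; apply: near_eq_cvg; apply: nearW => n.
  by rewrite /q /GRing.scale/= mulr1 (addrC (- k n)) invrN; ring.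
have qlim2 u : E u -> q n u ^+ 2 @[n --> \oo] --> derive1 f u ^+ 2.
  by move=> Eu; apply: cvgM; exact: qlim.
have qL n u : D u -> `|q n u ^+ 2| <= L ^+ 2.
  rewrite /= in_itv/= => Du.
  rewrite normrX lerXn2r ?nnegrE// /q normrM normfV (gtr0_norm (k0 n)).
  by rewrite ler_pdivrMr// hL// (ltW (k0 n)) k2.
have mq n : measurable_fun E (fun u => (q n u ^+ 2)%:E).
  apply/measurable_EFinP; apply: measurable_funTS.
  exact: continuous_measurable_fun.
have mdE : measurable_fun E (fun u => (derive1 f u ^+ 2)%:E).
  apply: (@emeasurable_fun_cvg _ _ _ _ (fun n u => (q n u ^+ 2)%:E)) => // u Eu.
  by apply: cvg_EFin; [exact: nearW|exact: qlim2].
(* On [range s] the value of [derive1 f] is not controlled, but every subset of a countable set is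
   measurable. *)
have mdD : measurable_fun D (fun u => (derive1 f u ^+ 2)%:E).
  rewrite (_ : D = E `|` (D `&` range s)); last first.
    rewrite /E setDE -setIUr.
    by rewrite [X in D `&` X]setUC setUv setIT.
  apply/measurable_funU => //; first exact: measurableI.
  split=> // _ Y mY; apply: (@measurable_subset_range _ s).
  by move=> u [[]].
have toE (g : R -> R) : measurable_fun D (fun u => (g u ^+ 2)%:E) ->
    (\int[mu]_(u in D) (g u ^+ 2)%:E = \int[mu]_(u in E) (g u ^+ 2)%:E)%E.
  move=> mg; apply: ge0_negligible_integral => //.
  by move=> u _; rewrite lee_fin sqr_ge0.
have dct : \int[mu]_(u in D) q n u ^+ 2 @[n --> \oo] --> \int[mu]_(u in D) derive1 f u ^+ 2.
  have [||||] := @dominated_convergence _ _ _ mu E mE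
    (fun n u => (q n u ^+ 2)%:E) (fun u => (derive1 f u ^+ 2)%:E) (cst (L ^+ 2)%:E) mq.
  - exact: mdE.
  - by apply: aeW => u Eu; apply: cvg_EFin; [exact: nearW|exact: qlim2].
  - have iD : mu.-integrable D (EFin \o cst (L ^+ 2)).
      by apply: continuous_itv_integrable => u; exact: cvg_cst.
    exact: (@integrableS _ _ _ mu D E _ (measurable_itv _) mE (@subDsetl _ D (range s)) iD).
  - by apply: aeW => u n [Du _]; rewrite lee_fin; exact: qL.
  move=> iE _ /= cvgE.
  rewrite /Rintegral (toE _ mdD).
  rewrite (_ : (fun n => _) = fun n => fine (\int[mu]_(u in E) (q n u ^+ 2)%:E)%E).
    by apply: fine_cvg; rewrite fineK//; exact: integrable_fin_num.
  apply/funext => n; rewrite toE//; apply/measurable_EFinP; apply: measurable_funTS.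
  exact: continuous_measurable_fun.
rewrite /inner (_ : (fun n => _) = fun n =>
    (2 * pi)^-1 * (2^-1 * \int[mu]_(u in D) q n u ^+ 2)); last first.
  apply/funext => n; rewrite -/(k n) autocorrelation_increment// ?(ltW (k0 n)) ?k2//.
  have -> : \int[mu]_(u in D) (f u - f (u - k n)) ^+ 2 =
      \int[mu]_(u in D) (k n ^+ 2 * q n u ^+ 2).
    by apply: eq_Rintegral => u _; rewrite -exprMn /q mulrCA divff ?mulr1// gt_eqF.
  rewrite RintegralZl//; last exact: (continuous_itv_integrable 0 (2 * pi) (cq2 n)).
  have := k0 n; move: (\int[mu]_(u in D) _) => I kn0.
  move: (2 * pi)^-1 => p; field.
  by rewrite gt_eqF.
have half (p y : R) : p * y / 2 = p * (2^-1 * y) by ring.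
rewrite half.
by apply: cvgMl_tmp; apply: cvgMl_tmp; exact: dct.
Qed.

Lemma continuous_autocorrelation : continuous C.
Proof.
move=> a.
have Ia : a \in `]a - 1, a + 1[%classic.
  by rewrite inE /= in_itv/=; apply/andP; split; lra.
(* This interval contains [u] and [u - x] for all [u] in a period and all [x] within 1 of [a], so
   [M * M] dominates the integrand. *)
have [M M0 fM] : exists2 M, 0 <= M & forall x, - (`|a| + 1) <= x <= 2 * pi + `|a| + 1 ->
    `|f x| <= M.
  have cw : {within `[- (`|a| + 1), 2 * pi + `|a| + 1], continuous f}.
    exact: continuous_subspaceT.
  have /compact_bounded[M [_ hM]] := continuous_compact cw (@segment_compact R _ _).
  exists (`|M| + 1) => [|x xab]; first by rewrite addr_ge0.
  apply: (hM (`|M| + 1)); first by rewrite (le_lt_trans (ler_norm M)) ?ltrDl.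
  by exists x => //; rewrite /= in_itv.
rewrite /conv; apply: cvgMl_tmp.
have ha := normr_ge0 a; have ha1 := ler_norm a; have ha2 := ler_norm (- a).
rewrite normrN in ha2.
apply: (@continuity_under_integral R _ _ mu
  (fun x u => f u * reflect_fun f (x - u)) D _ (a - 1) (a + 1) _ _ (cst (M * M))) => //.
- move=> x _; apply: continuous_itv_integrable => u; apply: cvgM; first exact: f_cont.
  rewrite /reflect_fun.
  apply: (@continuous_comp _ _ _ (fun u => - (x - u)) f); last exact: f_cont.
  apply: cvgN; apply: cvgB; [exact: cvg_cst|exact: cvg_id].
- apply: aeW => u _ x _; apply: cvgMl_tmp; rewrite /reflect_fun.
  apply: (@continuous_comp _ _ _ (fun x => - (x - u)) f); last exact: f_cont.
  by apply: cvgN; apply: cvgB; [exact: cvg_id|exact: cvg_cst].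
- by apply: continuous_itv_integrable => u; exact: cvg_cst.
- move=> x; rewrite /= in_itv/= => /andP[x1 x2]; apply: aeW => u /=.
  rewrite in_itv/= => /andP[u0 u2]; rewrite normrM ler_pM//.
    by apply: fM; apply/andP; split; lra.
  by rewrite /reflect_fun; apply: fM; apply/andP; split; lra.
Qed.

(** [rho f 0 - rho f u] is the average of [C 0 - C x] over [[0, u]], and averaging [d2 / 2 * x ^ 2]
    gives [d2 / 6 * u ^ 2]. *)
Lemma cvg_rho : (rho f 0 - rho f u) / u ^+ 2 @[u --> 0^'+] --> d2 / 6.
Proof.
apply/cvgrPdist_le => e e0.
have /cvgrPdist_le /(_ e e0) [dl /= dl0 hdl] := cvg_autocorrelation.
near=> u.
have u0 : 0 < u by near: u; exact: nbhs_right_gt.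
have C0 : inner f f = C 0.
  by rewrite /inner /conv; congr (_ * _); apply: eq_Rintegral => x _;
     rewrite /reflect_fun sub0r opprK.
have iC := continuous_itv_integrable 0 u continuous_autocorrelation.
have cst_int c : \int[mu]_(x in `[0, u]) c = c * u.
  by rewrite Rintegral_cst//= lebesgue_measure_itv/= lte_fin u0 sube0.
have icst c : mu.-integrable `[0, u] (EFin \o cst c).
  by apply: continuous_itv_integrable => x; exact: cvg_cst.
have sqr_cont c : continuous (fun x : R => c * x ^+ 2).
  by move=> x; apply: cvgM; [exact: cvg_cst|exact: exprn_continuous].
have sqr_int c : \int[mu]_(x in `[0, u]) (c * x ^+ 2) = c * u ^+ 3 / 3.
  rewrite /Rintegral (@continuous_FTC2 _ _ (fun x => c * x ^+ 3 / 3) 0 u)//.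
  - by rewrite expr0n/= mulr0 mul0r subr0.
  - exact: continuous_subspaceT.
  - have cF : continuous (fun x : R => c * x ^+ 3 / 3).
      move=> x; apply: cvgMr_tmp; apply: cvgMl_tmp; exact: exprn_continuous.
    split; first by move=> x _; exact: ex_derive.
      by apply: cvg_at_right_filter; exact: cF.
    by apply: cvg_at_left_filter; exact: cF.
  - by move=> x _; rewrite derive1E derive_val /GRing.scale/=; field.
have E : rho f 0 - rho f u = u^-1 * \int[mu]_(x in `[0, u]) (C 0 - C x).
  rewrite /rho eqxx gt_eqF// /int_from0 (ltW u0) C0 RintegralB//; last exact: icst.
  rewrite (_ : Rintegral _ _ (fun=> C 0) = C 0 * u); last exact: cst_int.
  by field; rewrite gt_eqF.
have idiff : mu.-integrable `[0, u] (EFin \o (fun x => C 0 - C x)).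
  apply: continuous_itv_integrable => y; apply: cvgB; first exact: cvg_cst.
  exact: continuous_autocorrelation.
(* An error [e] in the quadratic coefficient becomes [e / 3] after averaging, well within the
   tolerance. *)
have close x : 0 <= x <= u -> (d2 / 2 - e) * x ^+ 2 <= C 0 - C x <= (d2 / 2 + e) * x ^+ 2.
  move=> /andP[]; rewrite le_eqVlt => /predU1P[<- _|x0 xu].
    by rewrite subrr expr0n/= !mulr0 lexx.
  have := hdl x; rewrite /= sub0r normrN gtr0_norm// (le_lt_trans xu)// => /(_ isT x0).
  rewrite ler_distl => /andP[h1 h2].
  have x20 : 0 < x ^+ 2 by rewrite exprn_gt0.
  move: h1 h2; set t := (C 0 - C x) / x ^+ 2.
  have -> : C 0 - C x = t * x ^+ 2 by rewrite /t divfK// gt_eqF.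
  by rewrite !ler_pM2r// => h1 h2; apply/andP; split; lra.
have lo : (d2 / 2 - e) * u ^+ 3 / 3 <= \int[mu]_(x in `[0, u]) (C 0 - C x).
  rewrite -sqr_int; apply: le_Rintegral => //.
    exact: continuous_itv_integrable.
  by move=> x; rewrite /= in_itv/= => /close /andP[].
have hi : \int[mu]_(x in `[0, u]) (C 0 - C x) <= (d2 / 2 + e) * u ^+ 3 / 3.
  rewrite -sqr_int; apply: le_Rintegral => //.
    exact: continuous_itv_integrable.
  by move=> x; rewrite /= in_itv/= => /close /andP[].
rewrite E; move: lo hi; set I := \int[mu]_(x in _) _ => lo hi.
have u3 : 0 < u ^+ 3 by rewrite exprn_gt0.
set t := I / u ^+ 3.
have IE : I = t * u ^+ 3 by rewrite /t divfK// gt_eqF.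
have -> : u^-1 * I / u ^+ 2 = t by rewrite /t; field; rewrite gt_eqF.
move: lo hi; rewrite IE ![_ * u ^+ 3 / 3]mulrAC !ler_pM2r// => lo hi.
by rewrite ler_distl; apply/andP; split; lra.
Unshelve. all: by end_near. Qed.

End CovarianceAsymptotics.

Theorem proposition1p1 (R : realType) (f : R -> R)
  (f_cont : continuous f)
  (f_periodic : periodic f (2 * pi))
  (f_pwC1 : piecewise_C1 f)
  (f_gt0 : 0 < inner f f)
  (f'_gt0 : 0 < inner (derive1 f) (derive1 f))
  (d : measure_display) (Omega : measurableType d) (P : probability Omega R)
  (X : R -> {RV P >-> R})
  (X_gaussian : gaussian_process X)
  (X_centered : centered X)
  (X_stationary : stationary X)
  (X_paths : continuous_paths X)
  (X_cov : forall s t : R, 'E_P[fun w => (X s w * X t w)%R]%E = (rho f (t - s))%:E)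
  (a b : R) (ab : a <= b) :
  (\int[P]_w nb_zeros (fun t => X t w) a b =
   ((b - a) / pi *
    Num.sqrt (3^-1 * (inner (derive1 f) (derive1 f) / inner f f)))%:E)%E.
Proof.
have rho0 : rho f 0 = inner f f by rewrite /rho eqxx.
have r0 : 0 < rho f 0 by rewrite rho0.
have kappa0 : 0 < inner (derive1 f) (derive1 f) / 6 by rewrite divr_gt0.
rewrite (Rice X_gaussian X_centered X_paths X_cov r0 kappa0
  (cvg_rho f_cont f_periodic f_pwC1) ab) rho0.
(* The factor 2 of the Rice formula and the divisor 6 of [kappa] combine into 1/3. *)
by congr (_ * Num.sqrt _)%:E; field; rewrite gt_eqF.
Qed.
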